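(* For all integers $l_1,l_2\ge1$, $|m_1|\le l_1$, $|m_2|\le l_2$, $$MC(e_{l_1m_1},e_{l_2m_2})=\sum_{l_3=|l_1-l_2|+1}^{l_1+l_2-1}\ \sum_{m_3=-l_3}^{l_3}\Big(g^{l_3\,-m_3}_{l_1m_1l_2m_2}\Big)^2\Big(l_1(l_1+1)-l_3(l_3+1)\Big)$$ $$=\sum_{l_3=|l_1-l_2|+1}^{l_1+l_2-1}\Big(g^{l_3\,-(m_1+m_2)}_{l_1m_1l_2m_2}\Big)^2\Big(l_1(l_1+1)-l_3(l_3+1)\Big).$$
   Context: Use coordinates $(\lambda,\mu)\in(0,2\pi)\times(-1,1)$ on the unit sphere $\mathbb S^2$ ($\lambda$ longitude, $\mu$ height), with area element $d\lambda\,d\mu$ and Laplace–Beltrami operator $\Delta$. The Poisson bracket is $\{f,g\}=\partial_\lambda f\,\partial_\mu g-\partial_\mu f\,\partial_\lambda g$, extended complex-bilinearly to complex-valued functions, and $\langle f,g\rangle=\int_{\mathbb S^2} f\,g^*\,d\lambda\,d\mu$, where $^*$ is complex conjugation. For integers $l\ge 0$, $|m|\le l$, $Y_{lm}$ denotes the complex spherical harmonic: for $m\ge 0$, $Y_{lm}=(-1)^m\sqrt{\frac{2l+1}{4\pi}\frac{(l-m)!}{(l+m)!}}\,P_l^m(\mu)e^{im\lambda}$ with $P_l^m(\mu)=\frac{(1-\mu^2)^{m/2}}{2^l l!}\frac{d^{l+m}}{d\mu^{l+m}}(\mu^2-1)^l$, and $Y_{l\,-m}=(-1)^mY_{lm}^*$.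 These are orthonormal with $\Delta Y_{lm}=-l(l+1)Y_{lm}$. Put $\nabla^\perp f=(-\partial_\mu f,\partial_\lambda f)$ and $e_{lm}=\nabla^\perp Y_{lm}$. The Misiolek criterion of $u=\nabla^\perp f$, $v=\nabla^\perp g$ is $MC(u,v)=\langle\Delta\{f,g\},\{f,g\}\rangle-\langle\{\Delta f,g\},\{f,g\}\rangle.$ Structure constants: $\{Y_{l_1m_1},Y_{l_2m_2}\}=\sum_{l_3,m_3}G^{l_3m_3}_{l_1m_1l_2m_2}Y_{l_3m_3}$, and the real structure constants $g$ are defined by $G^{l_3m_3}_{l_1m_1l_2m_2}=-\mathrm i(-1)^{m_3}g^{l_3\,-m_3}_{l_1m_1l_2m_2}$; $g^{l_3m_3}_{l_1m_1l_2m_2}$ is taken to be $0$ if $|m_3|>l_3$. *)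

(* Defs.v *)
From Stdlib Require Import Reals ZArith ClassicalEpsilon.
From Coquelicot Require Import Coquelicot.

Set Implicit Arguments.

Local Open Scope R_scope.

(* A scalar function on the sphere is given in the coordinates
   (lam, mu) = (longitude, height); only its values on the open chart below
   are meaningful. *)
Definition scalar := R -> R -> C.
Definition field := R -> R -> C * C.

Definition chart (lam mu : R) : Prop := 0 < lam < 2 * PI /\ -1 < mu < 1.

Definition dC (f : R -> C) (t : R) : C :=
  (Derive (fun s => Re (f s)) t, Derive (fun s => Im (f s)) t).

Definition dlam (f : scalar) : scalar :=
  fun lam mu => dC (fun t => f t mu) lam.

Definition dmu (f : scalar) : scalar :=
  fun lam mu => dC (fun t => f lam t) mu.

Definition laplacian (f : scalar) : scalar := fun lam mu =>
  (dmu (fun a b => RtoC (1 - b ^ 2) * dmu f a b) lam mu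
   + RtoC (/ (1 - mu ^ 2)) * dlam (dlam f) lam mu)%C.

Definition bracket (f g : scalar) : scalar := fun lam mu =>
  (dlam f lam mu * dmu g lam mu - dmu f lam mu * dlam g lam mu)%C.

(* The area element in these coordinates is d lam d mu. *)
Definition inner (f g : scalar) : C :=
  RInt (V := C_R_CompleteNormedModule)
    (fun mu => RInt (V := C_R_CompleteNormedModule)
       (fun lam => (f lam mu * Cconj (g lam mu))%C) 0 (2 * PI))
    (-1) 1.

Definition gradperp (f : scalar) : field :=
  fun lam mu => ((- dmu f lam mu)%C, dlam f lam mu).

Definition assoc_legendre (l m : nat) (mu : R) : R :=
  sqrt (1 - mu ^ 2) ^ m / (2 ^ l * INR (fact l))
  * Derive_n (fun t => (t ^ 2 - 1) ^ l) (l + m) mu.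

Definition Ynonneg (l m : nat) : scalar := fun lam mu =>
  (RtoC ((-1) ^ m
         * sqrt ((2 * INR l + 1) / (4 * PI)
                 * (INR (fact (l - m)) / INR (fact (l + m))))
         * assoc_legendre l m mu)
   * (cos (INR m * lam), sin (INR m * lam)))%C.

Definition Y (l : nat) (m : Z) : scalar := fun lam mu =>
  if (0 <=? m)%Z then Ynonneg l (Z.to_nat m) lam mu
  else (RtoC ((-1) ^ Z.abs_nat m) * Cconj (Ynonneg l (Z.abs_nat m) lam mu))%C.

Definition e_field (l : nat) (m : Z) : field := gradperp (Y l m).

Definition stream (f : scalar) (u : field) : Prop :=
  forall lam mu, chart lam mu ->
    ex_derive (V := C_R_NormedModule) (fun t => f t mu) lam /\
    ex_derive (V := C_R_NormedModule) (fun t => f lam t) mu /\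
    u lam mu = gradperp f lam mu.

Definition MC_stream (f g : scalar) : C :=
  (inner (laplacian (bracket f g)) (bracket f g)
   - inner (bracket (laplacian f) g) (bracket f g))%C.

(* [MC_stream f g] involves [f] and [g] only through their first partial
   derivatives on the chart, so the choice of stream functions of [u] and [v]
   is immaterial. *)
Definition MC (u v : field) : C :=
  epsilon (inhabits (RtoC 0)) (fun c =>
    exists f g, stream f u /\ stream g v /\ c = MC_stream f g).

(* m runs over the integers from -l to l. *)
Definition sum_order {A : AbelianMonoid} (l : nat) (F : Z -> A) : A :=
  sum_n_m (fun k => F (Z.of_nat k - Z.of_nat l)%Z) 0 (2 * l).

(* A finite linear combination; the values G l m with |m| > l are
   irrelevant. *)
Definition is_expansion (h : scalar) (G : nat -> Z -> C) : Prop :=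
  exists N : nat,
    (forall l m, (N < l)%nat -> (Z.abs m <= Z.of_nat l)%Z ->
       G l m = RtoC 0) /\
    (forall lam mu, chart lam mu ->
       h lam mu =
       sum_n_m (fun l => sum_order l (fun m => (G l m * Y l m lam mu)%C)) 0 N).

Definition structure_constant (l1 : nat) (m1 : Z) (l2 : nat) (m2 : Z) :
    nat -> Z -> C :=
  epsilon (inhabits (fun _ _ => RtoC 0))
    (is_expansion (bracket (Y l1 m1) (Y l2 m2))).

Definition real_structure_constant (l1 : nat) (m1 : Z) (l2 : nat) (m2 : Z) :
    nat -> Z -> R :=
  epsilon (inhabits (fun _ _ => 0)) (fun g =>
    (forall l3 m3, (Z.abs m3 <= Z.of_nat l3)%Z ->
       structure_constant l1 m1 l2 m2 l3 m3 =
       (- Ci * RtoC (powerRZ (-1) m3) * RtoC (g l3 (- m3)%Z))%C) /\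
    (forall l3 m3, (Z.of_nat l3 < Z.abs m3)%Z -> g l3 m3 = 0)).

(* Main.v *)
Require Import Defs.
From Stdlib Require Import Reals ZArith Lia Lra ClassicalEpsilon.
From Coquelicot Require Import Coquelicot.
Local Open Scope R_scope.

(** The factor (1 - mu^2)^(|m|/2) is not smooth at the poles when m is odd, and its derivative
    carries a quotient by 1 - mu^2. Hence derivatives of profiles are only taken for -1 < mu < 1,
    and every integral in mu is reduced to that of a genuine polynomial, to which the fundamental
    theorem applies up to the endpoints. The lower bound comes from the upper one applied to another
    pair: the component of {Y1, Y2} along Y3 equals, up to a constant factor, the pairing of Y1 with
    the bracket of Y3 and the conjugate of Y2. That bracket only has degrees below l2 + l3, so it is
    orthogonal to Y1 once l2 + l3 <= l1. [MC], [structure_constant] and [real_structure_constant]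
    are picked by [epsilon], so each needs a witness and a reason why the pick is harmless:
    [MC_stream] sees only gradients on the chart, coefficients of an expansion are inner products,
    and g enters only through its square. *)

(** In the variable [mu] a spherical harmonic is [radial l m mu], that is
    [(1 - mu^2)^(|m|/2)] times a polynomial of degree [l - |m|], times
    [cis m lam].  A bracket of two harmonics has the single longitudinal
    frequency [m = m1 + m2], and its profile is [(1 - mu^2)^(|m|/2)] times a
    real polynomial of degree less than [l1 + l2 - |m|]; hence it is [i] times a
    real combination [sum_l a_l Y_{l m}] with [l < l1 + l2].  Cyclicity of
    [int {f, g} h], obtained by integrating by parts, turns this upper bound into
    the lower bound [|l1 - l2| < l].  Orthonormality identifies [i a_l] with the
    structure constants, so [g^2 = a_l^2], and since the [Y_{l m}] are
    eigenfunctions of the Laplacian both terms of [MC] are diagonal sums in the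
    [a_l^2].  Orthogonality comes from Green's formula for the Legendre equation;
    the same formula gives a recursion in [m] for the norms, started at [m = l]. *)

(* Coquelicot states equations in a structure whose carrier is convertible to
   [R]; [ring] and [field] only work once the equation is typed in [R]. *)
Ltac eq_in_R := lazymatch goal with |- ?a = ?b => change (@eq R a b) end.

(** * Finite sums with at most one nonzero term *)

Lemma sum_n_m_zero_loc {A : AbelianMonoid} (u : nat -> A) a b :
  (forall k, (a <= k <= b)%nat -> u k = zero) -> sum_n_m u a b = zero.
Proof.
  intros H; rewrite (sum_n_m_ext_loc u (fun _ => zero)) by exact H.
  apply sum_n_m_const_zero.
Qed.

Lemma sum_n_m_single {A : AbelianMonoid} (u : nat -> A) a b k0 :
  (a <= k0 <= b)%nat ->
  (forall k, (a <= k <= b)%nat -> k <> k0 -> u k = zero) ->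
  sum_n_m u a b = u k0.
Proof.
  intros L H.
  assert (E : sum_n_m u k0 b = u k0).
  { rewrite sum_Sn_m by lia.
    rewrite sum_n_m_zero_loc; [apply plus_zero_r|].
    intros k Hk; apply H; lia. }
  destruct (Nat.eq_dec a k0) as [->|ne]; trivial.
  destruct k0 as [|k0]; [lia|].
  rewrite (sum_n_m_Chasles u a k0 b) by lia.
  rewrite E, sum_n_m_zero_loc; [apply plus_zero_l|].
  intros k Hk; apply H; lia.
Qed.

(** * Polynomial functions *)

(** Horner form, with n a strict bound on the degree, so that index 0 leaves only the zero function.
    The pointwise equations keep the predicate stable under pointwise equality of functions. *)
Inductive poly_below : nat -> (R -> R) -> Prop :=
| poly_below_0 f : (forall t, f t = 0) -> poly_below 0 f
| poly_below_S n c g f :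
    poly_below n g -> (forall t, f t = c + t * g t) -> poly_below (S n) f.

Lemma poly_below_ext n f g :
  (forall t, f t = g t) -> poly_below n f -> poly_below n g.
Proof.
  intros E H; destruct H as [f H | n c h f Hh H].
  - apply poly_below_0; intros t; now rewrite <- E.
  - apply poly_below_S with c h; trivial; intros t; now rewrite <- E.
Qed.

Lemma poly_below_zero n f : (forall t, f t = 0) -> poly_below n f.
Proof.
  revert f; induction n as [|n IH]; intros f H.
  - now apply poly_below_0.
  - apply poly_below_S with 0 f; [now apply IH|].
    intros t; rewrite H; ring.
Qed.

Lemma poly_below_le n n' f :
  (n <= n')%nat -> poly_below n f -> poly_below n' f.
Proof.
  intros L H; revert n' L.
  induction H as [f H | n c g f Hg IH H]; intros n' L.
  - now apply poly_below_zero.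
  - destruct n' as [|n']; [lia|].
    apply poly_below_S with c g; trivial; apply IH; lia.
Qed.

Lemma poly_below_const n c : poly_below (S n) (fun _ => c).
Proof.
  apply poly_below_S with c (fun _ => 0).
  - now apply poly_below_zero.
  - intros t; ring.
Qed.

Lemma poly_below_shift n f : poly_below n f -> poly_below (S n) (fun t => t * f t).
Proof.
  intros H; apply poly_below_S with 0 f; trivial; intros t; ring.
Qed.

Lemma poly_below_plus n f g :
  poly_below n f -> poly_below n g -> poly_below n (fun t => f t + g t).
Proof.
  intros H; revert g; induction H as [f H | n c f1 f Hf IH H]; intros g Hg.
  - apply poly_below_ext with g; trivial; intros t; rewrite H; ring.
  - inversion Hg as [|n' c' g1 g' Hg1 E]; subst.
    apply poly_below_S with (c + c') (fun t => f1 t + g1 t); [now apply IH|].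
    intros t; rewrite H, E; ring.
Qed.

Lemma poly_below_scal n c f : poly_below n f -> poly_below n (fun t => c * f t).
Proof.
  intros H; induction H as [f H | n d g f Hg IH H].
  - apply poly_below_0; intros t; rewrite H; ring.
  - apply poly_below_S with (c * d) (fun t => c * g t); trivial.
    intros t; rewrite H; ring.
Qed.

Lemma poly_below_minus n f g :
  poly_below n f -> poly_below n g -> poly_below n (fun t => f t - g t).
Proof.
  intros Hf Hg.
  apply poly_below_ext with (fun t => f t + (-1) * g t); [intros t; ring|].
  apply poly_below_plus; trivial; now apply poly_below_scal.
Qed.

(** The asymmetric indices express degree < a times degree <= b without a truncated subtraction. *)
Lemma poly_below_mult a b f g :
  poly_below a f -> poly_below (S b) g -> poly_below (a + b) (fun t => f t * g t).
Proof.
  intros H Hg; induction H as [f H | a c f1 f Hf IH H].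
  - apply poly_below_zero; intros t; rewrite H; ring.
  - apply poly_below_ext with (fun t => c * g t + t * (f1 t * g t)).
    + intros t; rewrite H; ring.
    + apply poly_below_plus.
      * apply poly_below_le with (S b); [lia|]; now apply poly_below_scal.
      * now apply poly_below_shift.
Qed.

Lemma poly_below_pow a f n :
  poly_below (S a) f -> poly_below (S (n * a)) (fun t => f t ^ n).
Proof.
  intros H; induction n as [|n IH].
  - apply (poly_below_const 0 1).
  - apply (poly_below_mult (S a) (n * a)); trivial.
Qed.

Lemma poly_below_id n : poly_below (S (S n)) (fun t => t).
Proof.
  apply poly_below_ext with (fun t => t * 1); [intros t; ring|].
  apply poly_below_shift, poly_below_const.
Qed.

Lemma poly_below_derive n f :
  poly_below n f ->
  (forall t, ex_derive f t) /\ poly_below (pred n) (Derive f).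
Proof.
  intros H; induction H as [f H | n c g f Hg [IHe IHd] H].
  - assert (D : forall t, is_derive f t 0).
    { intros t; apply is_derive_ext with (fun _ => 0); [now intros|].
      apply (is_derive_const 0 t). }
    split; [intros t; now exists 0|].
    apply poly_below_zero; intros t; now apply is_derive_unique.
  - assert (D : forall t, is_derive f t (g t + t * Derive g t)).
    { intros t; apply is_derive_ext with (fun t => c + t * g t); [now intros|].
      auto_derive; [apply IHe | change (Derive (fun x => g x) t) with (Derive g t); ring]. }
    split; [intros t; eexists; apply D|].
    apply poly_below_ext with (fun t => g t + t * Derive g t).
    { intros t; symmetry; now apply is_derive_unique. }
    simpl; apply poly_below_plus; trivial.
    destruct n as [|n].
    + apply poly_below_0; intros t.
      inversion IHd as [d Hd|]; rewrite Hd; ring.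
    + simpl in IHd; now apply poly_below_shift.
Qed.

Lemma poly_below_ex_derive n f t : poly_below n f -> ex_derive f t.
Proof. intros H; now apply (poly_below_derive n f). Qed.

Lemma poly_below_Derive n f : poly_below n f -> poly_below (pred n) (Derive f).
Proof. intros H; now apply (poly_below_derive n f). Qed.

Lemma poly_below_continuous n f t : poly_below n f -> continuous f t.
Proof.
  intros H; apply @ex_derive_continuous; now apply poly_below_ex_derive with n.
Qed.

Lemma poly_below_ex_RInt n f a b : poly_below n f -> ex_RInt f a b.
Proof.
  intros H; apply @ex_RInt_continuous; intros t _;
  now apply poly_below_continuous with n.
Qed.

Lemma is_RInt_poly_derive n F f a b :
  poly_below n F -> (forall t, is_derive F t (f t)) ->
  is_RInt f a b (F b - F a).
Proof.
  intros H D.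
  apply (is_RInt_derive F f); intros t _; [apply D|].
  apply continuous_ext with (Derive F).
  - intros s; now apply is_derive_unique.
  - apply poly_below_continuous with (pred n); now apply poly_below_Derive.
Qed.

(** c is the coefficient of t^n in a polynomial of degree at most n; c = 0 is allowed. *)
Definition lead (n : nat) (f : R -> R) (c : R) : Prop :=
  poly_below n (fun t => f t - c * t ^ n).

Lemma poly_below_lead n f : poly_below (S n) f -> exists c, lead n f c.
Proof.
  revert f; unfold lead; induction n as [|n IH]; intros f H;
    inversion H as [|n' c g f' Hg E]; subst.
  - exists c; apply poly_below_0; intros t; rewrite E.
    inversion Hg as [g' Eg|]; rewrite Eg; simpl; ring.
  - destruct (IH g Hg) as [d Hd]; exists d.
    apply poly_below_S with c (fun t => g t - d * t ^ n); trivial.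
    intros t; rewrite E; simpl; ring.
Qed.

Lemma lead_poly_below n f c : lead n f c -> poly_below (S n) f.
Proof.
  intros H.
  apply poly_below_ext with (fun t => (f t - c * t ^ n) + c * t ^ n);
    [intros t; ring|].
  apply poly_below_plus; [apply poly_below_le with n; [lia|exact H]|].
  apply poly_below_scal.
  apply poly_below_le with (S (n * 1)); [lia|].
  apply (poly_below_pow 1), poly_below_id.
Qed.

Lemma lead_Derive n f c : lead (S n) f c -> lead n (Derive f) (INR (S n) * c).
Proof.
  intros H.
  assert (Hf := lead_poly_below _ _ _ H).
  apply poly_below_Derive in H.
  apply poly_below_ext with (2 := H); intros t.
  apply is_derive_unique; auto_derive.
  - repeat split; now apply poly_below_ex_derive with (S (S n)).
  - change (Derive (fun x => f x) t) with (Derive f t).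
    change (pred (S n)) with n; simpl; ring.
Qed.

(** Triangular elimination: [r (d + k)] has exact degree k, so a multiple of it removes the top
    coefficient. The shift d will be |m|, the least degree of a harmonic of order m, and [N] stays
    free because the expansions are later cut at different degrees. *)
Lemma poly_below_span (r : nat -> R -> R) d n f :
  (forall k, exists c, c <> 0 /\ lead k (r (d + k)%nat) c) ->
  poly_below n f ->
  exists a : nat -> R,
    (forall k, (k < d)%nat \/ (d + n <= k)%nat -> a k = 0) /\
    forall N t, (d + n <= S N)%nat -> f t = sum_n (fun k => a k * r k t) N.
Proof.
  intros Hr; revert f; induction n as [|n IH]; intros f H.
  - exists (fun _ => 0); split; trivial.
    intros N t _; inversion H as [f' E|]; rewrite E.
    rewrite (sum_n_ext _ (fun _ => 0)) by (intros; apply Rmult_0_l).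
    unfold sum_n; rewrite sum_n_m_const; ring.
  - destruct (poly_below_lead _ _ H) as [c Hc].
    destruct (Hr n) as [e [He0 He]].
    destruct (IH (fun t => f t - (c / e) * r (d + n)%nat t)) as [a [Ha0 Ha]].
    { apply poly_below_ext with
        (fun t => (f t - c * t ^ n) - (c / e) * (r (d + n)%nat t - e * t ^ n)).
      - intros t; now field.
      - apply poly_below_minus; trivial; now apply poly_below_scal. }
    exists (fun k => a k + if Nat.eq_dec k (d + n) then c / e else 0); split.
    + intros k Hk; rewrite Ha0 by lia.
      destruct (Nat.eq_dec k (d + n)); [lia | ring].
    + intros N t L.
      rewrite (sum_n_ext _ (fun k => plus (a k * r k t)
        ((if Nat.eq_dec k (d + n) then c / e else 0) * r k t))).
      2: { intros k; apply Rmult_plus_distr_r. }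
      unfold sum_n; rewrite sum_n_m_plus; fold (sum_n (fun k => a k * r k t) N).
      rewrite <- Ha by lia.
      rewrite (sum_n_m_single _ 0 N (d + n)) by
        (lia || (intros k _ Hk; destruct (Nat.eq_dec k (d + n)); [easy | apply Rmult_0_l])).
      destruct (Nat.eq_dec (d + n) (d + n)) as [_|]; [|easy].
      change plus with Rplus; ring.
Qed.

(** * Associated Legendre functions *)

(* [P_l^k = (1 - t^2)^(k/2) / (2^l l!) * leg l k]. *)
Definition leg (l k : nat) : R -> R :=
  Derive_n (fun t => (t ^ 2 - 1) ^ l) (l + k).

Lemma lead_rodrigues l : lead (2 * l) (fun t => (t ^ 2 - 1) ^ l) 1.
Proof.
  induction l as [|l IH].
  - apply poly_below_0; intros t; simpl; ring.
  - apply poly_below_ext with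
      (fun t => t * (t * ((t ^ 2 - 1) ^ l - 1 * t ^ (2 * l))) + (-1) * (t ^ 2 - 1) ^ l).
    { intros t; replace (2 * S l)%nat with (S (S (2 * l))) by lia; simpl; ring. }
    replace (2 * S l)%nat with (S (S (2 * l))) by lia.
    apply poly_below_plus.
    + now apply poly_below_shift, poly_below_shift.
    + apply poly_below_scal, poly_below_le with (S (2 * l)); [lia|].
      now apply lead_poly_below with 1.
Qed.

Lemma lead_rodrigues_Derive_n l i :
  (i <= 2 * l)%nat ->
  lead (2 * l - i) (Derive_n (fun t => (t ^ 2 - 1) ^ l) i)
    (INR (fact (2 * l)) / INR (fact (2 * l - i))).
Proof.
  induction i as [|i IH]; intros L.
  - replace (2 * l - 0)%nat with (2 * l)%nat by lia.
    replace (_ / _) with 1 by (field; apply INR_fact_neq_0).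
    apply lead_rodrigues.
  - replace (_ / _) with
      (INR (S (2 * l - S i)) * (INR (fact (2 * l)) / INR (fact (2 * l - i)))).
    + apply lead_Derive.
      replace (S (2 * l - S i)) with (2 * l - i)%nat by lia.
      apply IH; lia.
    + replace (2 * l - i)%nat with (S (2 * l - S i)) by lia.
      rewrite fact_simpl, mult_INR; field.
      split; [apply INR_fact_neq_0 | apply not_0_INR; lia].
Qed.

(** Past i = 2 * l the subtraction truncates and the bound becomes 1, which is still true because
    the derivative is then zero. *)
Lemma poly_below_rodrigues_Derive_n l i :
  poly_below (S (2 * l - i)) (Derive_n (fun t => (t ^ 2 - 1) ^ l) i).
Proof.
  destruct (Nat.le_gt_cases i (2 * l)) as [L|L].
  - eapply lead_poly_below; now apply lead_rodrigues_Derive_n.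
  - apply poly_below_le with 0%nat; [lia|].
    induction L as [|i L IH].
    + assert (H := lead_rodrigues_Derive_n l (2 * l) (le_n _)).
      replace (2 * l - 2 * l)%nat with 0%nat in H by lia.
      apply (poly_below_Derive 1); now apply lead_poly_below with (1 := H).
    + now apply (poly_below_Derive 0).
Qed.

Lemma lead_leg l k :
  (k <= l)%nat -> lead (l - k) (leg l k) (INR (fact (2 * l)) / INR (fact (l - k))).
Proof.
  intros L; unfold leg.
  replace (l - k)%nat with (2 * l - (l + k))%nat by lia.
  apply lead_rodrigues_Derive_n; lia.
Qed.

Lemma poly_below_leg l k : poly_below (S (l - k)) (leg l k).
Proof.
  replace (l - k)%nat with (2 * l - (l + k))%nat by lia.
  apply poly_below_rodrigues_Derive_n.
Qed.

Lemma ex_derive_leg l k t : ex_derive (leg l k) t.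
Proof. eapply poly_below_ex_derive, poly_below_leg. Qed.

Lemma Derive_leg l k t : Derive (leg l k) t = leg l (S k) t.
Proof. unfold leg; now rewrite Nat.add_succ_r. Qed.

Lemma is_derive_leg l k t : is_derive (leg l k) t (leg l (S k) t).
Proof. rewrite <- Derive_leg; apply Derive_correct, ex_derive_leg. Qed.

(** With w = (t^2 - 1)^l one has (t^2 - 1) w' = 2 l t w; this is that equation differentiated i + 1
    times. *)
Lemma rodrigues_ode l i t :
  let w := Derive_n (fun t => (t ^ 2 - 1) ^ l) in
  (t ^ 2 - 1) * w (S (S i)) t + 2 * (INR i + 1 - INR l) * t * w (S i) t
  + (INR i + 1) * (INR i - 2 * INR l) * w i t = 0.
Proof.
  intros w.
  assert (D : forall i t, is_derive (w i) t (w (S i) t)).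
  { intros j s; apply Derive_correct.
    eapply poly_below_ex_derive, poly_below_rodrigues_Derive_n. }
  assert (E : forall i t, ex_derive (fun x => w i x) t) by (intros; eexists; apply D).
  assert (DE : forall i t, Derive (fun x => w i x) t = w (S i) t) by reflexivity.
  (* Differentiating an identity F = 0 gives the next one; the base case and the induction step both
     proceed this way. *)
  assert (N : forall (F : R -> R) t d, (forall x, F x = 0) -> is_derive F t d -> d = 0).
  { intros F s d H HF; rewrite <- (is_derive_unique _ _ _ HF).
    rewrite (Derive_ext _ (fun _ => 0)) by exact H; apply Derive_const. }
  revert t; induction i as [|i IH]; intros t.
  - assert (H0 : forall t, (t ^ 2 - 1) * w 1%nat t - 2 * INR l * t * w 0%nat t = 0).
    { intros s.
      assert (Hw : Derive (fun t => (t ^ 2 - 1) ^ l) s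
         = INR l * (2 * s) * (s ^ 2 - 1) ^ pred l).
      { apply is_derive_unique; auto_derive; trivial.
        change (s * (s * 1) + - (1)) with (s ^ 2 - 1); ring. }
      change (w 1%nat s) with (Derive (fun t => (t ^ 2 - 1) ^ l) s); rewrite Hw.
      change (w 0%nat s) with ((s ^ 2 - 1) ^ l).
      destruct l as [|l]; [simpl; ring | simpl pred; rewrite S_INR; simpl; ring]. }
    eapply N with (t := t) (1 := H0).
    auto_derive; [repeat split; apply E|].
    rewrite !DE; simpl INR; ring.
  - eapply N with (t := t) (1 := IH).
    auto_derive; [repeat split; apply E|].
    rewrite !DE, !S_INR; ring.
Qed.

(** Legendre's equation differentiated k times: [rodrigues_ode] at i = l + k. *)
Lemma leg_ode l k t :
  (1 - t ^ 2) * leg l (S (S k)) t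
  = 2 * (INR k + 1) * t * leg l (S k) t
    + (INR l + INR k + 1) * (INR k - INR l) * leg l k t.
Proof.
  assert (H := rodrigues_ode l (l + k) t); cbv zeta in H.
  unfold leg; rewrite !Nat.add_succ_r; rewrite plus_INR in H.
  revert H; generalize (Derive_n (fun t => (t ^ 2 - 1) ^ l)); intros w H.
  lra.
Qed.

Lemma poly_below_weight k : poly_below (S (k * 2)) (fun t => (1 - t ^ 2) ^ k).
Proof.
  apply (poly_below_pow 2).
  apply poly_below_S with 1 (fun t => t * (-1)); [|intros; ring].
  apply poly_below_shift, (poly_below_const 0).
Qed.

Lemma poly_below_weight_leg j l k l' k' :
  poly_below (S (j * 2 + (l - k + (l' - k'))))
    (fun t => (1 - t ^ 2) ^ j * (leg l k t * leg l' k' t)).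
Proof.
  apply (poly_below_mult (S (j * 2)) (l - k + (l' - k')) (fun t => (1 - t ^ 2) ^ j)
           (fun t => leg l k t * leg l' k' t)).
  - apply poly_below_weight.
  - apply (poly_below_mult (S (l - k)) (l' - k')); apply poly_below_leg.
Qed.

Lemma is_RInt_poly_derive_0 n F f :
  poly_below n F -> (forall t, is_derive F t (f t)) -> F (-1) = 0 -> F 1 = 0 ->
  is_RInt f (-1) 1 0.
Proof.
  intros P D H0 H1.
  replace 0 with (F 1 - F (-1)) by (rewrite H0, H1; ring).
  now apply is_RInt_poly_derive with n.
Qed.

Lemma weight_endpoint k t : t ^ 2 = 1 -> (1 - t ^ 2) ^ S k = 0.
Proof. intros ->; simpl; ring. Qed.

(* Green's formula for the Legendre operator [((1 - t^2)^(k+1) p')']. *)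
Lemma is_RInt_leg_green l l' k :
  is_RInt (fun t => (INR l + INR k + 1) * (INR l - INR k)
                    * ((1 - t ^ 2) ^ k * (leg l k t * leg l' k t))
                    - (1 - t ^ 2) ^ S k * (leg l (S k) t * leg l' (S k) t))
    (-1) 1 0.
Proof.
  eapply is_RInt_poly_derive_0 with
    (F := fun t => (-1) * ((1 - t ^ 2) ^ S k * (leg l (S k) t * leg l' k t))).
  - apply poly_below_scal, poly_below_weight_leg.
  - intros t; auto_derive.
    + repeat split; apply ex_derive_leg.
    + change (fun x => leg ?a ?b x) with (leg a b).
      rewrite !Derive_leg.
      assert (H := leg_ode l k t).
      simpl pred.
      (* The terms are regrouped so that the left side of [leg_ode] appears as a factor; the
         equation then turns the second derivative into the eigenvalue (l + k + 1)(l - k). *)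
      transitivity ((1 - t ^ 2) ^ k * leg l' k t
          * (2 * (INR k + 1) * t * leg l (S k) t - (1 - t ^ 2) * leg l (S (S k)) t)
        - (1 - t ^ 2) ^ S k * leg l (S k) t * leg l' (S k) t).
      * change (match k with 0%nat => 1 | S _ => INR k + 1 end) with (INR (S k)).
        rewrite S_INR.
        change (1 + - (t * (t * 1))) with (1 - t ^ 2);
        change ((1 - t ^ 2) ^ S k) with ((1 - t ^ 2) * (1 - t ^ 2) ^ k); ring.
      * rewrite H; ring.
  - rewrite weight_endpoint by ring; ring.
  - rewrite weight_endpoint by ring; ring.
Qed.

Lemma ex_RInt_leg l l' k :
  ex_RInt (fun t => (1 - t ^ 2) ^ k * (leg l k t * leg l' k t)) (-1) 1.
Proof.
  eapply poly_below_ex_RInt, poly_below_weight_leg.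
Qed.

Definition leg_inner (l l' k : nat) : R :=
  RInt (fun t => (1 - t ^ 2) ^ k * (leg l k t * leg l' k t)) (-1) 1.

Lemma leg_inner_S l l' k :
  leg_inner l l' (S k) = (INR l + INR k + 1) * (INR l - INR k) * leg_inner l l' k.
Proof.
  assert (H := is_RInt_leg_green l l' k).
  assert (E := RInt_correct _ _ _ (ex_RInt_leg l l' k)).
  assert (E' := RInt_correct _ _ _ (ex_RInt_leg l l' (S k))).
  apply (is_RInt_scal _ _ _ ((INR l + INR k + 1) * (INR l - INR k))) in E.
  assert (M := is_RInt_minus _ _ _ _ _ _ E E').
  apply (is_RInt_unique (V := R_CompleteNormedModule)) in H.
    apply (is_RInt_unique (V := R_CompleteNormedModule)) in M.
  assert (M' := eq_trans (eq_sym M) H).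
  unfold minus, plus, opp, scal, mult in M'; simpl in M'; unfold mult in M'; simpl in M'.
  unfold leg_inner; simpl pow; lra.
Qed.

Lemma leg_inner_sym l l' k : leg_inner l l' k = leg_inner l' l k.
Proof. apply RInt_ext; intros t _; f_equal; apply Rmult_comm. Qed.

(** [leg_inner l l' (S k)] is symmetric in l and l', whereas the factor in [leg_inner_S] belongs to
    l alone. Comparing both orders leaves (l - l')(l + l' + 1) times the integral equal to 0. *)
Lemma leg_inner_orthogonal l l' k : l <> l' -> leg_inner l l' k = 0.
Proof.
  intros ne.
  assert (H := leg_inner_S l l' k).
  assert (H' := leg_inner_S l' l k).
  rewrite (leg_inner_sym l' l), (leg_inner_sym l' l k), H in H'.
  assert (F : (INR l - INR l') * (INR l + INR l' + 1) * leg_inner l l' k = 0) by lra.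
  apply Rmult_integral in F as [F|F]; trivial.
  apply Rmult_integral in F as [F|F].
  - apply Rminus_diag_uniq in F; now apply INR_eq in F.
  - generalize (pos_INR l) (pos_INR l'); lra.
Qed.

(** The recursion in l comes from integrating the derivative of t (1 - t^2)^(l+1), which vanishes at
    both ends, after writing t^2 as 1 - (1 - t^2). *)
Lemma RInt_weight l :
  RInt (fun t => (1 - t ^ 2) ^ l) (-1) 1
  = 2 * (2 ^ l * INR (fact l)) ^ 2 / INR (fact (2 * l + 1)).
Proof.
  induction l as [|l IH].
  - rewrite (RInt_ext _ (fun _ => 1)) by reflexivity.
    rewrite RInt_const; unfold scal; simpl; unfold mult; simpl; field.
  - assert (H : is_RInt (fun t => (2 * INR l + 3) * (1 - t ^ 2) ^ S l
                                - 2 * (INR l + 1) * (1 - t ^ 2) ^ l) (-1) 1 0).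
    { eapply is_RInt_poly_derive_0 with (F := fun t => (1 - t ^ 2) ^ S l * t).
      - apply (poly_below_mult (S (S l * 2)) 1 (fun t => (1 - t ^ 2) ^ S l)).
        + apply poly_below_weight.
        + apply (poly_below_id 0).
      - intros t; auto_derive; trivial; simpl pred; simpl pow.
        change (match l with 0%nat => 1 | S _ => INR l + 1 end) with (INR (S l)).
        rewrite S_INR; change (1 + - (t * (t * 1))) with (1 - t * (t * 1)); ring.
      - rewrite weight_endpoint by ring; ring.
      - rewrite weight_endpoint by ring; ring. }
    assert (E : forall j, ex_RInt (fun t => (1 - t ^ 2) ^ j) (-1) 1).
    { intros j; eapply poly_below_ex_RInt, poly_below_weight. }
    assert (E0 := is_RInt_scal _ _ _ (2 * (INR l + 1)) _ (RInt_correct _ _ _ (E l))).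
    assert (E1 := is_RInt_scal _ _ _ (2 * INR l + 3) _ (RInt_correct _ _ _ (E (S l)))).
    assert (M := is_RInt_minus _ _ _ _ _ _ E1 E0).
    apply (is_RInt_unique (V := R_CompleteNormedModule)) in H.
    apply (is_RInt_unique (V := R_CompleteNormedModule)) in M.
    assert (M' := eq_trans (eq_sym M) H).
    unfold minus, plus, opp, scal, mult in M'; simpl in M'; unfold mult in M'; simpl in M'.
    change (fun t => (1 - t * (t * 1)) ^ l) with (fun t => (1 - t ^ 2) ^ l) in M'.
    rewrite IH in M'.
    apply Rmult_eq_reg_l with (2 * INR l + 3); [|generalize (pos_INR l); lra].
    match type of M' with ?A + - ?B = 0 => transitivity B end.
    + simpl pow; lra.
    + replace (2 * S l + 1)%nat with (S (S (2 * l + 1))) by lia.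
      rewrite !fact_simpl, !mult_INR, !S_INR.
      rewrite plus_INR, mult_INR; simpl (INR 2); simpl (INR 1); simpl pow.
      field; repeat split; try apply INR_fact_neq_0; generalize (pos_INR l); lra.
Qed.

Lemma leg_inner_norm l k :
  (k <= l)%nat ->
  leg_inner l l k = (2 ^ l * INR (fact l)) ^ 2 * (2 / (2 * INR l + 1))
                    * (INR (fact (l + k)) / INR (fact (l - k))).
Proof.
  (* The value is known at k = l, so the induction runs on j = l - k and reads [leg_inner_S]
     backwards; its factor is nonzero for k < l. *)
  intros L; replace k with (l - (l - k))%nat by lia.
  generalize (l - k)%nat (Nat.le_sub_l l k); clear k L; intros j L.
  assert (P := pos_INR l).
  induction j as [|j IH].
  - replace (l - 0)%nat with l by lia.
    replace (l - l)%nat with 0%nat by lia.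
    (* [leg l l] has degree 0, hence equals its leading coefficient. *)
    assert (T : forall t, leg l l t = INR (fact (2 * l))).
    { intros t; assert (H := lead_leg l l (le_n l)).
      rewrite Nat.sub_diag in H.
      inversion H as [f E|]; specialize (E t); simpl (fact 0) in E.
      simpl in E |- *; unfold Rdiv in E; rewrite Rinv_1 in E; lra. }
    unfold leg_inner.
    rewrite (is_RInt_unique (V := R_CompleteNormedModule) _ _ _
      (scal (INR (fact (2 * l)) ^ 2) (RInt (fun t => (1 - t ^ 2) ^ l) (-1) 1))).
    2: { apply is_RInt_ext with (fun t => scal (INR (fact (2 * l)) ^ 2) ((1 - t ^ 2) ^ l)).
         - intros t _; rewrite !T; unfold scal; simpl; unfold mult; simpl; ring.
         - apply (is_RInt_scal (V := R_NormedModule)), (RInt_correct (V := R_CompleteNormedModule)).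
           eapply poly_below_ex_RInt, poly_below_weight. }
    rewrite RInt_weight; unfold scal; simpl; unfold mult; simpl.
    replace (l + (l + 0) + 1)%nat with (S (2 * l)) by lia.
    replace (l + (l + 0))%nat with (2 * l)%nat by lia.
    replace (l + l)%nat with (2 * l)%nat by lia.
    rewrite fact_simpl, mult_INR, S_INR, mult_INR; simpl (INR 2).
    field; split; [lra | apply INR_fact_neq_0].
  - set (k := (l - S j)%nat).
    assert (Hk : (l - j = S k)%nat) by lia.
    rewrite Hk, leg_inner_S in IH.
    assert (Hj : (l - k = S j)%nat) by lia.
    replace (l - S k)%nat with j in IH by lia.
    rewrite Hj; rewrite Nat.add_succ_r in IH.
    rewrite !fact_simpl, !mult_INR, !S_INR, plus_INR in *.
    assert (HR : INR l - INR k = INR j + 1).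
    { rewrite <- minus_INR, Hj, S_INR by lia; ring. }
    rewrite HR in IH.
    assert (0 <= INR j) by apply pos_INR.
    assert (0 <= INR k) by apply pos_INR.
    apply Rmult_eq_reg_l with ((INR l + INR k + 1) * (INR j + 1)).
    + rewrite IH by lia; field; repeat split; try apply INR_fact_neq_0; lra.
    + apply Rmult_integral_contrapositive; lra.
Qed.

(** * Normalised latitudinal profiles *)

Lemma is_derive_sqrt_pow k t :
  -1 < t < 1 ->
  is_derive (fun t => sqrt (1 - t ^ 2) ^ k) t
    (- (INR k * t * sqrt (1 - t ^ 2) ^ k / (1 - t ^ 2))).
Proof.
  intros Ht.
  assert (P : 0 < 1 - t ^ 2) by nra.
  assert (Q := sqrt_lt_R0 _ P).
  evar_last.
  - apply is_derive_pow, is_derive_sqrt; [|exact P].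
    auto_derive; [exact I | reflexivity].
  - replace (INR k * t * sqrt (1 - t ^ 2) ^ k / (1 - t ^ 2))
      with (INR k * t * sqrt (1 - t ^ 2) ^ k / sqrt (1 - t ^ 2) ^ 2)
      by (rewrite pow2_sqrt; lra).
    revert Q; generalize (sqrt (1 - t ^ 2)); intros r Q.
    destruct k as [|k]; [simpl; field; lra|].
    simpl pred; simpl pow; field; lra.
Qed.

(** The sign occurs only for m >= 0: for m < 0 the factor (-1)^|m| in [Y] cancels the one inside
    [Ynonneg]. *)
Definition norm_const (l : nat) (m : Z) : R :=
  (if (0 <=? m)%Z then (-1) ^ Z.abs_nat m else 1)
  * sqrt ((2 * INR l + 1) / (4 * PI)
          * (INR (fact (l - Z.abs_nat m)) / INR (fact (l + Z.abs_nat m))))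
  / (2 ^ l * INR (fact l)).

Lemma norm_const_sqr l m :
  norm_const l m ^ 2 =
  (2 * INR l + 1) / (4 * PI)
  * (INR (fact (l - Z.abs_nat m)) / INR (fact (l + Z.abs_nat m)))
  / (2 ^ l * INR (fact l)) ^ 2 /\ 0 < norm_const l m ^ 2.
Proof.
  assert (A := INR_fact_lt_0 (l - Z.abs_nat m)).
  assert (B := INR_fact_lt_0 (l + Z.abs_nat m)).
  assert (C := INR_fact_lt_0 l).
  assert (D : 0 < 2 ^ l) by (apply pow_lt; lra).
  assert (P := PI_RGT_0); assert (L := pos_INR l).
  assert (H : norm_const l m ^ 2 =
  (2 * INR l + 1) / (4 * PI)
  * (INR (fact (l - Z.abs_nat m)) / INR (fact (l + Z.abs_nat m)))
  / (2 ^ l * INR (fact l)) ^ 2).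
  { unfold norm_const, Rdiv at 1.
    rewrite !Rpow_mult_distr, pow2_sqrt.
    - replace ((if (0 <=? m)%Z then (-1) ^ Z.abs_nat m else 1) ^ 2) with 1.
      + field; repeat split; lra.
      + destruct (0 <=? m)%Z; [|ring].
        rewrite <- pow_mult, Nat.mul_comm, pow_mult.
        replace ((-1) ^ 2) with 1 by ring; now rewrite pow1.
    - apply Rmult_le_pos; apply Rlt_le, Rdiv_lt_0_compat; lra. }
  split; trivial; rewrite H.
  apply Rdiv_lt_0_compat.
  - apply Rmult_lt_0_compat; apply Rdiv_lt_0_compat; lra.
  - now apply pow_lt, Rmult_lt_0_compat.
Qed.

Lemma norm_const_neq_0 l m : norm_const l m <> 0.
Proof.
  intros E; destruct (norm_const_sqr l m) as [_ H]; rewrite E in H; lra.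
Qed.

Definition radial (l : nat) (m : Z) (t : R) : R :=
  norm_const l m * (sqrt (1 - t ^ 2) ^ Z.abs_nat m * leg l (Z.abs_nat m) t).

Lemma is_derive_radial l m t :
  -1 < t < 1 ->
  is_derive (radial l m) t
    (norm_const l m * (sqrt (1 - t ^ 2) ^ Z.abs_nat m
       * (leg l (S (Z.abs_nat m)) t
          - INR (Z.abs_nat m) * t / (1 - t ^ 2) * leg l (Z.abs_nat m) t))).
Proof.
  intros Ht; apply is_derive_scal.
  evar_last.
  - apply (is_derive_mult (fun t => sqrt (1 - t ^ 2) ^ Z.abs_nat m) (leg l (Z.abs_nat m)) t).
    + now apply is_derive_sqrt_pow.
    + apply is_derive_leg.
    + intros; apply Rmult_comm.
  - unfold plus, mult; simpl; field; nra.
Qed.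

Lemma sqrt_sqr_pow k t : -1 < t < 1 ->
  sqrt (1 - t ^ 2) ^ k * sqrt (1 - t ^ 2) ^ k = (1 - t ^ 2) ^ k.
Proof.
  intros Ht; rewrite <- Rpow_mult_distr, sqrt_sqrt; [easy | nra].
Qed.

(** The two profiles have the same order, so their square roots pair up into the polynomial weight
    of [leg_inner]. The value / (2 * PI) is compensated by the integral over longitude. *)
Lemma is_RInt_radial l l' m :
  (Z.abs m <= Z.of_nat l)%Z ->
  is_RInt (fun t => radial l m t * radial l' m t) (-1) 1
    (if Nat.eq_dec l l' then / (2 * PI) else 0).
Proof.
  intros L.
  apply is_RInt_ext with (fun t => scal (norm_const l m * norm_const l' m)
    ((1 - t ^ 2) ^ Z.abs_nat m * (leg l (Z.abs_nat m) t * leg l' (Z.abs_nat m) t))).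
  { rewrite Rmin_left, Rmax_right by lra; intros t Ht.
    rewrite <- sqrt_sqr_pow by trivial.
    unfold radial, scal; simpl; unfold mult; simpl; ring. }
  assert (H := RInt_correct _ _ _ (ex_RInt_leg l l' (Z.abs_nat m))).

  fold (leg_inner l l' (Z.abs_nat m)) in H.
  apply (is_RInt_scal _ _ _ (norm_const l m * norm_const l' m)) in H.
  evar_last; [exact H|].
  unfold scal; simpl; unfold mult; simpl.
  destruct (Nat.eq_dec l l') as [<-|ne].
  - rewrite leg_inner_norm by lia.
    destruct (norm_const_sqr l m) as [E _].
    replace (norm_const l m * norm_const l m) with (norm_const l m ^ 2) by ring.
    rewrite E.
    assert (P := PI_RGT_0); assert (Q := pos_INR l).
    assert (2 ^ l <> 0) by (apply pow_nonzero; lra).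
    field; repeat split; try apply INR_fact_neq_0; lra.
  - rewrite leg_inner_orthogonal by trivial; ring.
Qed.

(* The operator [h |-> ((1 - t^2) h')' - m^2 / (1 - t^2) h] is the latitudinal
   part of the Laplacian at longitudinal frequency [m]. *)
Definition legendre_op (m : Z) (h g : R -> R) : Prop :=
  exists h', forall t, -1 < t < 1 ->
    is_derive h t (h' t) /\
    is_derive (fun t => (1 - t ^ 2) * h' t) t (g t + IZR m ^ 2 / (1 - t ^ 2) * h t).

Lemma legendre_op_Derive m h g t :
  legendre_op m h g -> -1 < t < 1 ->
  Derive (fun t => (1 - t ^ 2) * Derive h t) t - IZR m ^ 2 / (1 - t ^ 2) * h t = g t.
Proof.
  intros [h' H] Ht.
  rewrite (is_derive_unique _ _ (g t + IZR m ^ 2 / (1 - t ^ 2) * h t)); [ring|].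
  apply is_derive_ext_loc with (fun t => (1 - t ^ 2) * h' t); [|now apply H].
  apply (locally_interval _ t (-1) 1); try apply Ht.
  intros s H1 H2; f_equal; symmetry; apply is_derive_unique; now apply H.
Qed.

Lemma legendre_op_sum m (h g : nat -> R -> R) (a : nat -> R) N :
  (forall l, legendre_op m (h l) (g l)) ->
  legendre_op m (fun t => sum_n (fun l => a l * h l t) N)
                (fun t => sum_n (fun l => a l * g l t) N).
Proof.
  intros H; induction N as [|N [h' IH]].
  - destruct (H 0%nat) as [h' Hh]; exists (fun t => a 0%nat * h' t).
    intros t Ht; destruct (Hh t Ht) as [H1 H2]; split.
    + apply is_derive_ext with (fun t => a 0%nat * h 0%nat t).
      { intros s; now rewrite sum_O. }
      now apply is_derive_scal.
    + rewrite !sum_O.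
      apply is_derive_ext with (fun t => a 0%nat * ((1 - t ^ 2) * h' t)).
      { intros s; apply Rmult_comm || (simpl; ring). }
      replace (_ + _) with (a 0%nat * (g 0%nat t + IZR m ^ 2 / (1 - t ^ 2) * h 0%nat t))
        by (unfold Rdiv; ring).
      now apply is_derive_scal.
  - destruct (H (S N)) as [k' Hk]; exists (fun t => h' t + a (S N) * k' t).
    intros t Ht; destruct (IH t Ht) as [H1 H2]; destruct (Hk t Ht) as [K1 K2]; split.
    + apply is_derive_ext with
        (fun t => plus (sum_n (fun l => a l * h l t) N) (a (S N) * h (S N) t)).
      { intros s; now rewrite sum_Sn. }
      apply (is_derive_plus _ _ t (h' t)); trivial; now apply is_derive_scal.
    + rewrite !sum_Sn.
      apply is_derive_ext with
        (fun t => plus ((1 - t ^ 2) * h' t) (a (S N) * ((1 - t ^ 2) * k' t))).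
      { intros s; unfold plus; simpl; ring. }
      evar_last.
      * eapply @is_derive_plus; [exact H2 | apply is_derive_scal, K2].
      * unfold plus; simpl; unfold Rdiv; ring.
Qed.

(** This is [leg_ode] conjugated by (1 - t^2)^(k/2) with k = |m|: the derivatives of that factor
    produce the term m^2 / (1 - t^2) and shift the eigenvalue from (l + k + 1)(l - k) to l (l +
    1). *)
Lemma legendre_op_radial l m :
  legendre_op m (radial l m) (fun t => - (INR l * (INR l + 1)) * radial l m t).
Proof.
  eexists; intros t Ht; split; [now apply is_derive_radial|].
  set (k := Z.abs_nat m).
  replace (IZR m ^ 2) with (INR k ^ 2).
  2: { unfold k; rewrite INR_IZR_INZ, Zabs2Nat.id_abs, abs_IZR, pow2_abs; easy. }
  (* Multiplying the first derivative by 1 - t^2 clears its quotient before the second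
     differentiation. *)
  apply is_derive_ext_loc with (fun t => norm_const l m * (sqrt (1 - t ^ 2) ^ k
     * ((1 - t ^ 2) * leg l (S k) t - INR k * t * leg l k t))).
  { apply (locally_interval _ t (-1) 1); try apply Ht.
    simpl; intros s H1 H2; eq_in_R; field; nra. }
  evar_last.
  - apply is_derive_scal, (is_derive_mult (fun t => sqrt (1 - t ^ 2) ^ k)).
    + now apply is_derive_sqrt_pow.
    + auto_derive; [repeat split; apply ex_derive_leg | reflexivity].
    + intros; apply Rmult_comm.
  - change (fun x => leg ?a ?b x) with (leg a b).
    rewrite !Derive_leg.
    assert (E := leg_ode l k t).
    assert (E' : leg l (S (S k)) t = (2 * (INR k + 1) * t * leg l (S k) t +
      (INR l + INR k + 1) * (INR k - INR l) * leg l k t) / (1 - t ^ 2)).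
    { rewrite <- E; field; nra. }
    rewrite E'; unfold radial; fold k.
    unfold plus, mult; simpl; field; nra.
Qed.

(** j counts the surplus factors 1 - t^2 in a product of profiles of orders m1 and m2 compared with
    order m1 + m2. With j = 0 the orders have no opposite signs, which gives the equality that
    cancels the polar term of the bracket. *)
Lemma abs_nat_add m1 m2 :
  exists j, (Z.abs_nat m1 + Z.abs_nat m2 = Z.abs_nat (m1 + m2) + 2 * j)%nat /\
    (j = 0%nat -> IZR m1 * INR (Z.abs_nat m2) = IZR m2 * INR (Z.abs_nat m1)).
Proof.
  rewrite !INR_IZR_INZ, !Zabs2Nat.id_abs.
  assert (H : forall a b, (a * Z.abs b = b * Z.abs a)%Z ->
             IZR a * IZR (Z.abs b) = IZR b * IZR (Z.abs a)).
  { intros a b E; now rewrite <- !mult_IZR, E. }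
  destruct (Z_le_gt_dec 0 (m1 * m2)) as [P|P].
  - exists 0%nat; split; [nia|]; intros _; apply H; nia.
  - exists (Nat.min (Z.abs_nat m1) (Z.abs_nat m2)); split; [nia|].
    intros E; exfalso; nia.
Qed.

(** * Selection rules *)

(** The profile of a bracket of two waves with the factor i taken out; see [bracket_wave]. *)
Definition radial_bracket (m1 : Z) (h1 : R -> R) (m2 : Z) (h2 : R -> R) (t : R) : R :=
  IZR m1 * h1 t * Derive h2 t - IZR m2 * Derive h1 t * h2 t.

(** Differentiating the square roots creates a term in t / (1 - t^2) with coefficient m2 |m1| - m1
    |m2|. If j = 0 this coefficient is zero; otherwise one of the j surplus factors 1 - t^2 absorbs
    the pole. Both cases give the same degree bound, strict because in the first one every term
    contains a derivative of a polynomial. *)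
Lemma radial_bracket_poly l1 m1 l2 m2 :
  (Z.abs m1 <= Z.of_nat l1)%Z -> (Z.abs m2 <= Z.of_nat l2)%Z ->
  exists q, poly_below (l1 + l2 - Z.abs_nat (m1 + m2)) q /\
    forall t, -1 < t < 1 ->
      radial_bracket m1 (radial l1 m1) m2 (radial l2 m2) t
      = sqrt (1 - t ^ 2) ^ Z.abs_nat (m1 + m2) * q t.
Proof.
  intros L1 L2.
  destruct (abs_nat_add m1 m2) as [j [Hj Hj0]].
  set (n1 := Z.abs_nat m1) in *; set (n2 := Z.abs_nat m2) in *.
  assert (P : poly_below (l1 - n1 + (l2 - n2))
    (fun t => IZR m1 * (leg l2 (S n2) t * leg l1 n1 t)
              - IZR m2 * (leg l1 (S n1) t * leg l2 n2 t))).
  { assert (D : forall l n, poly_below (l - n) (leg l (S n))).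
    { intros l n; apply poly_below_ext with (Derive (leg l n)).
      - apply Derive_leg.
      - apply (poly_below_Derive (S (l - n))), poly_below_leg. }
    apply poly_below_minus; apply poly_below_scal.
    - rewrite Nat.add_comm.
      apply (poly_below_mult (l2 - n2) (l1 - n1)); [apply D | apply poly_below_leg].
    - apply (poly_below_mult (l1 - n1) (l2 - n2)); [apply D | apply poly_below_leg]. }
  set (c := norm_const l1 m1 * norm_const l2 m2).
  assert (F : forall t, -1 < t < 1 ->
     radial_bracket m1 (radial l1 m1) m2 (radial l2 m2) t =
     c * (sqrt (1 - t ^ 2) ^ (n1 + n2) *
      ((IZR m1 * (leg l2 (S n2) t * leg l1 n1 t)
              - IZR m2 * (leg l1 (S n1) t * leg l2 n2 t))
       + (IZR m2 * INR n1 - IZR m1 * INR n2) * (t / (1 - t ^ 2))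
          * (leg l1 n1 t * leg l2 n2 t)))).
  { intros t Ht; unfold radial_bracket.
    rewrite !(is_derive_unique _ _ _ (is_derive_radial _ _ _ Ht)).
    unfold radial; fold n1 n2; rewrite pow_add; unfold c, Rdiv; ring. }
  destruct j as [|j].
  - eexists; split.
    + apply poly_below_scal with (c := c).
      apply poly_below_le with (2 := P); lia.
    + intros t Ht; rewrite F by trivial.
      replace (n1 + n2)%nat with (Z.abs_nat (m1 + m2)) by lia.
      rewrite Hj0 by trivial; ring.
  - exists (fun t => c * ((1 - t ^ 2) ^ j *
      ((1 - t ^ 2) * (IZR m1 * (leg l2 (S n2) t * leg l1 n1 t)
              - IZR m2 * (leg l1 (S n1) t * leg l2 n2 t))
       + (IZR m2 * INR n1 - IZR m1 * INR n2) *
          (t * (leg l1 n1 t * leg l2 n2 t))))); split.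
    + apply poly_below_scal.
      replace (l1 + l2 - Z.abs_nat (m1 + m2))%nat
        with (S (j * 2) + (S (l1 - n1 + (l2 - n2))))%nat by lia.
      apply (poly_below_mult (S (j * 2)) (S (l1 - n1 + (l2 - n2)))
                (fun t => (1 - t ^ 2) ^ j)); [apply poly_below_weight|].
      apply poly_below_plus.
      * apply poly_below_ext with (fun t => (IZR m1 * (leg l2 (S n2) t * leg l1 n1 t)
              - IZR m2 * (leg l1 (S n1) t * leg l2 n2 t)) * (1 - t ^ 2) ^ 1).
        { intros t; ring. }
        replace (S (S (l1 - n1 + (l2 - n2)))) with (l1 - n1 + (l2 - n2) + 2)%nat by lia.
        apply (poly_below_mult _ 2 _ (fun t => (1 - t ^ 2) ^ 1)); trivial.
        apply (poly_below_weight 1).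
      * apply poly_below_scal, poly_below_shift.
        apply (poly_below_mult (S (l1 - n1)) (l2 - n2)); apply poly_below_leg.
    + intros t Ht; rewrite F by trivial.
      rewrite Hj, pow_add, pow_mult, pow2_sqrt by nra.
      change ((1 - t ^ 2) ^ S j) with ((1 - t ^ 2) * (1 - t ^ 2) ^ j).
      field; nra.
Qed.

Lemma radial_bracket_expansion l1 m1 l2 m2 :
  (Z.abs m1 <= Z.of_nat l1)%Z -> (Z.abs m2 <= Z.of_nat l2)%Z ->
  exists a : nat -> R,
    (forall l, (l < Z.abs_nat (m1 + m2))%nat \/ (l1 + l2 <= l)%nat -> a l = 0) /\
    forall N t, (l1 + l2 <= S N)%nat -> -1 < t < 1 ->
      radial_bracket m1 (radial l1 m1) m2 (radial l2 m2) t
      = sum_n (fun l => a l * radial l (m1 + m2) t) N.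
Proof.
  intros L1 L2.
  destruct (radial_bracket_poly l1 m1 l2 m2 L1 L2) as [q [Hq E]].
  set (m := (m1 + m2)%Z) in *.
  destruct (poly_below_span (fun l t => norm_const l m * leg l (Z.abs_nat m) t)
              (Z.abs_nat m) (l1 + l2 - Z.abs_nat m) q) as [a [Ha0 Ha]]; trivial.
  (* For l >= |m| the polynomial part of the profile has exact degree l - |m|, its leading
     coefficient being nonzero. *)
  { intros k; set (l := (Z.abs_nat m + k)%nat).
    assert (H := lead_leg l (Z.abs_nat m) ltac:(lia)).
    replace (l - Z.abs_nat m)%nat with k in H by lia.
    exists (norm_const l m * (INR (fact (2 * l)) / INR (fact k))); split.
    - apply Rmult_integral_contrapositive; split; [apply norm_const_neq_0|].
      assert (A := INR_fact_lt_0 (2 * l)); assert (B := INR_fact_lt_0 k).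
      apply Rgt_not_eq, Rdiv_lt_0_compat; trivial.
    - eapply poly_below_ext; [|exact (poly_below_scal _ (norm_const l m) _ H)].
      intros t; simpl; ring. }
  exists a; split.
  - intros l Hl; apply Ha0; lia.
  - intros N t HN Ht; rewrite E, (Ha N t) by (trivial; lia).
    rewrite <- (sum_n_mult_l (K := R_Ring)).
    apply sum_n_ext; intros l; unfold radial, mult; simpl; ring.
Qed.

Lemma is_RInt_sum_n (f : nat -> R -> R) c a b N :
  (forall l, (l <= N)%nat -> is_RInt (f l) a b (c l)) ->
  is_RInt (fun t => sum_n (fun l => f l t) N) a b (sum_n c N).
Proof.
  induction N as [|N IH]; intros H.
  - rewrite sum_O; apply is_RInt_ext with (f 0%nat); [|now apply H].
    intros t _; now rewrite sum_O.
  - rewrite sum_Sn.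
    apply is_RInt_ext with (fun t => plus (sum_n (fun l => f l t) N) (f (S N) t)).
    { intros t _; now rewrite sum_Sn. }
    apply (is_RInt_plus (V := R_NormedModule)); [apply IH; auto | now apply H].
Qed.

(** Parseval's identity for a fixed order m. *)
Lemma is_RInt_radial_expansion m (c a : nat -> R) N :
  (forall l, (l < Z.abs_nat m)%nat -> a l = 0) ->
  is_RInt (fun t => sum_n (fun l => c l * radial l m t) N
                    * sum_n (fun l => a l * radial l m t) N) (-1) 1
    (sum_n (fun l => c l * a l) N / (2 * PI)).
Proof.
  intros Ha.
  apply is_RInt_ext with (fun t => sum_n (fun l' => sum_n (fun l =>
    scal (a l' * c l) (radial l' m t * radial l m t)) N) N).
  { intros t _.
    rewrite <- (sum_n_mult_l (K := R_Ring)); apply sum_n_ext; intros l'.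
    rewrite (Rmult_comm _ (a l' * _)).
    rewrite <- (sum_n_mult_l (K := R_Ring)); apply sum_n_ext; intros l.
    unfold scal, mult; simpl; unfold mult; simpl; ring. }
  unfold Rdiv; rewrite <- (sum_n_mult_r (K := R_Ring)).
  apply is_RInt_sum_n; intros l' L'.
  evar_last.
  - apply is_RInt_sum_n with (c := fun l =>
      if Nat.eq_dec l l' then mult (c l' * a l') (/ (2 * PI)) else 0).
    intros l L.
    (* Degrees below |m| lie outside the range of [is_RInt_radial]; their terms vanish through
       [a]. *)
    destruct (Nat.lt_ge_cases l' (Z.abs_nat m)) as [M|M].
    + rewrite Ha by trivial.
      apply is_RInt_ext with (fun _ => 0).
      { intros t _; unfold scal; simpl; unfold mult; simpl; ring. }
      evar_last; [apply (is_RInt_const (V := R_NormedModule))|].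
      unfold scal; simpl; unfold mult; simpl; destruct (Nat.eq_dec l l'); ring.
    + evar_last.
      * apply (is_RInt_scal (V := R_NormedModule)), is_RInt_radial; lia.
      * unfold scal; simpl; unfold mult; simpl.
        destruct (Nat.eq_dec l' l) as [<-|ne].
        -- destruct (Nat.eq_dec l' l') as [_|]; [eq_in_R; ring | easy].
        -- destruct (Nat.eq_dec l l'); [congruence | eq_in_R; ring].
  - unfold sum_n; rewrite (sum_n_m_single _ 0 N l'); [|lia|].
    + now destruct (Nat.eq_dec l' l').
    + intros k _ ne; now destruct (Nat.eq_dec k l').
Qed.

(* [int {Y1, Y2} Y3 = int Y1 {Y3, Y2}] up to conjugations; the boundary terms of the
   integration by parts vanish because [radial l1 m1 * radial l2 m2 * radial l3 (m1 + m2)]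
   is a polynomial divisible by [1 - t ^ 2] unless [m1 = m2 = 0]. *)
Lemma is_RInt_radial_bracket_low l1 m1 l2 m2 l3 :
  (Z.abs m1 <= Z.of_nat l1)%Z -> (Z.abs m2 <= Z.of_nat l2)%Z ->
  (Z.abs (m1 + m2) <= Z.of_nat l3)%Z -> (l2 + l3 <= l1)%nat ->
  is_RInt (fun t => radial_bracket m1 (radial l1 m1) m2 (radial l2 m2) t
                    * radial l3 (m1 + m2) t) (-1) 1 0.
Proof.
  intros L1 L2 L3 L.
  set (m3 := (m1 + m2)%Z) in *.
  (* Conjugating Y2 replaces m2 by -m2, so this bracket has order m1. Its degrees stay below l2 + l3
     <= l1, whence [a l1 = 0] and the orthogonality [A]. *)
  destruct (radial_bracket_expansion l3 m3 l2 (- m2) L3 ltac:(lia)) as [a [Ha0 Ha]].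
  replace (m3 + - m2)%Z with m1 in * by lia.
  assert (A : is_RInt (fun t => radial l1 m1 t
     * radial_bracket m3 (radial l3 m3) (- m2) (radial l2 (- m2)) t) (-1) 1 0).
  { apply is_RInt_ext with (fun t => sum_n (fun l =>
      scal (a l) (radial l1 m1 t * radial l m1 t)) l1).
    { rewrite Rmin_left, Rmax_right by lra; intros t Ht.
      rewrite (Ha l1 t) by (trivial; lia).
      rewrite <- (sum_n_mult_l (K := R_Ring)); apply sum_n_ext; intros l.
      unfold scal, mult; simpl; unfold mult; simpl; ring. }
    evar_last.
    - apply is_RInt_sum_n with (c := fun l => 0); intros l Hl.
      evar_last; [apply (is_RInt_scal (V := R_NormedModule)), is_RInt_radial; lia|].
      unfold scal; simpl; unfold mult; simpl.
      destruct (Nat.eq_dec l1 l) as [<-|ne]; [rewrite Ha0 by lia|]; ring.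
    - apply (sum_n_m_const_zero (G := R_AbelianGroup)). }
  set (T2 := radial l2 (- m2)) in *.
  assert (HT2 : exists d, forall t, radial l2 m2 t = d * T2 t).
  { exists (norm_const l2 m2 / norm_const l2 (- m2)); intros t.
    unfold T2, radial; replace (Z.abs_nat (- m2)) with (Z.abs_nat m2) by lia.
    field; apply norm_const_neq_0. }
  destruct HT2 as [d HT2].
  set (T1 := radial l1 m1) in *; set (T3 := radial l3 m3) in *.
  assert (B : is_RInt (fun t => IZR m2 * Derive (fun t => T1 t * T2 t * T3 t) t) (-1) 1 0).
  { destruct (Z.eq_dec m2 0) as [E0|N0].
    { apply is_RInt_ext with (fun _ => 0).
      { intros t _; rewrite E0; eq_in_R; ring. }
      evar_last; [apply (is_RInt_const (V := R_NormedModule))|].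
      unfold scal; simpl; unfold mult; simpl; ring. }
    (* As m3 = m1 + m2, the sum of the absolute values is even, and it is positive because m2 is
       nonzero: the square roots multiply to an integral power [S k] of 1 - t^2, which kills the
       boundary terms. *)
    destruct (Z.Even_or_Odd (Z.abs m1 + Z.abs m2 + Z.abs m3)) as [[K HK]|[K HK]]; [|lia].
    destruct (Z.abs_nat K) as [|k] eqn:Ek; [lia|].
    set (c := norm_const l1 m1 * norm_const l2 (- m2) * norm_const l3 m3).
    set (Q := fun t => c * (leg l1 (Z.abs_nat m1) t *
      ((1 - t ^ 2) ^ S k * (leg l2 (Z.abs_nat m2) t * leg l3 (Z.abs_nat m3) t)))).
    assert (HQ : forall t, -1 < t < 1 -> T1 t * T2 t * T3 t = Q t).
    { intros t Ht; unfold Q; rewrite <- (pow2_sqrt (1 - t ^ 2)) at 1 by nra.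
      rewrite <- pow_mult.
      replace (2 * S k)%nat with (Z.abs_nat m1 + (Z.abs_nat m2 + Z.abs_nat m3))%nat by lia.
      rewrite !pow_add; unfold T1, T2, T3, radial, c.
      replace (Z.abs_nat (- m2)) with (Z.abs_nat m2) by lia; ring. }
    assert (PQ : exists n, poly_below n Q).
    { eexists; apply poly_below_scal.
      eapply (poly_below_mult (S (l1 - Z.abs_nat m1))); [apply poly_below_leg|].
      apply poly_below_weight_leg. }
    destruct PQ as [n PQ].
    apply is_RInt_ext with (fun t => IZR m2 * Derive Q t).
    { rewrite Rmin_left, Rmax_right by lra; intros t Ht; f_equal.
      apply Derive_ext_loc, (locally_interval _ t (-1) 1); try apply Ht.
      simpl; intros s H1 H2; symmetry; now apply HQ. }
    apply is_RInt_poly_derive_0 with n (fun t => IZR m2 * Q t).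
    - now apply poly_below_scal.
    - intros t; apply is_derive_scal, Derive_correct.
      now apply poly_below_ex_derive with n.
    - unfold Q; rewrite weight_endpoint by ring; ring.
    - unfold Q; rewrite weight_endpoint by ring; ring. }
  (* With m3 = m1 + m2, the integrand of [A] minus that of [B] is m1 T1 T2' T3 - m2 T1' T2 T3; the
     factor d turns T2 back into [radial l2 m2]. *)
  assert (M := is_RInt_scal _ _ _ d _ (is_RInt_minus _ _ _ _ _ _ A B)).
  evar_last.
  - eapply is_RInt_ext with (2 := M).
    rewrite Rmin_left, Rmax_right by lra; intros t Ht.
    assert (D1 := is_derive_radial l1 m1 t Ht); fold T1 in D1.
    assert (D2 := is_derive_radial l2 (- m2) t Ht); fold T2 in D2.
    assert (D3 := is_derive_radial l3 m3 t Ht); fold T3 in D3.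
    assert (E1 : ex_derive (fun x => T1 x) t) by (eexists; apply D1).
    assert (E2 : ex_derive (fun x => T2 x) t) by (eexists; apply D2).
    assert (E3 : ex_derive (fun x => T3 x) t) by (eexists; apply D3).
    assert (D : Derive (fun t => T1 t * T2 t * T3 t) t =
      Derive T1 t * T2 t * T3 t + T1 t * Derive T2 t * T3 t + T1 t * T2 t * Derive T3 t).
    { apply is_derive_unique; auto_derive; [now repeat split|].
      change (fun x => T1 x) with T1; change (fun x => T2 x) with T2;
      change (fun x => T3 x) with T3; ring. }
    rewrite D; unfold radial_bracket.
    rewrite (Derive_ext _ _ t HT2), Derive_scal, HT2.
    change (fun t => T2 t) with T2.
    unfold m3; rewrite opp_IZR, plus_IZR.
    unfold scal, minus, plus, opp; simpl; unfold mult; simpl; ring.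
  - unfold scal, minus, plus, opp; simpl; unfold mult; simpl; ring.
Qed.

(** The coefficient of degree l is 2 * PI times the integral of the bracket profile against
    [radial l (m1 + m2)]. For l <= |l1 - l2| that integral is zero by [is_RInt_radial_bracket_low]
    with the larger degree in first place. *)
Lemma radial_bracket_coefficients l1 m1 l2 m2 :
  (1 <= l1)%nat -> (1 <= l2)%nat ->
  (Z.abs m1 <= Z.of_nat l1)%Z -> (Z.abs m2 <= Z.of_nat l2)%Z ->
  exists a : nat -> R,
    (forall l, (l < Z.abs_nat (m1 + m2))%nat -> a l = 0) /\
    (forall l, (l < Z.abs_nat (Z.of_nat l1 - Z.of_nat l2) + 1)%nat -> a l = 0) /\
    (forall l, (l1 + l2 - 1 < l)%nat -> a l = 0) /\
    forall t, -1 < t < 1 ->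
      radial_bracket m1 (radial l1 m1) m2 (radial l2 m2) t
      = sum_n (fun l => a l * radial l (m1 + m2) t) (l1 + l2 - 1).
Proof.
  intros G1 G2 L1 L2.
  destruct (radial_bracket_expansion l1 m1 l2 m2 L1 L2) as [a [Ha0 Ha]].
  exists a; split; [intros; apply Ha0; lia|]; split; [|split].
  - intros l Hl.
    destruct (Nat.lt_ge_cases l (Z.abs_nat (m1 + m2))) as [M|M]; [apply Ha0; lia|].
    set (b := radial_bracket m1 (radial l1 m1) m2 (radial l2 m2)) in *.
    (* An indicator as the second coefficient sequence extracts [a l] from Parseval's identity. *)
    set (e := fun k => if Nat.eq_dec k l then 1 else 0).
    assert (A : is_RInt (fun t => b t * radial l (m1 + m2) t) (-1) 1
                  (a l / (2 * PI))).
    { assert (S : forall u : nat -> R, sum_n (fun k => e k * u k) (l1 + l2) = u l).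
      { intros u; unfold sum_n; rewrite (sum_n_m_single _ 0 _ l); unfold e.
        - destruct (Nat.eq_dec l l); [eq_in_R; ring|easy].
        - lia.
        - intros k _ ne; destruct (Nat.eq_dec k l); [easy|]; apply Rmult_0_l. }
      assert (H := is_RInt_radial_expansion (m1 + m2) e a (l1 + l2)
                     (fun k Hk => Ha0 k (or_introl Hk))).
      rewrite S in H.
      apply is_RInt_ext with (2 := H).
      rewrite Rmin_left, Rmax_right by lra; intros t Ht.
      rewrite S, <- Ha by (trivial; lia); apply Rmult_comm. }
    assert (B : is_RInt (fun t => b t * radial l (m1 + m2) t) (-1) 1 0).
    { destruct (Nat.le_gt_cases l2 l1).
      - apply is_RInt_radial_bracket_low; lia.
      (* Here l1 < l2: antisymmetry of the bracket exchanges the two harmonics. *)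
      - rewrite Z.add_comm.
        assert (H1 : is_RInt (fun t => radial_bracket m2 (radial l2 m2) m1 (radial l1 m1) t
           * radial l (m2 + m1) t) (-1) 1 0) by (apply is_RInt_radial_bracket_low; lia).
        evar_last.
        + apply is_RInt_ext with (2 := is_RInt_opp _ _ _ _ H1).
          intros t _; unfold b, radial_bracket, opp; simpl; ring.
        + unfold opp; simpl; ring. }
    apply (is_RInt_unique (V := R_CompleteNormedModule)) in A.
    apply (is_RInt_unique (V := R_CompleteNormedModule)) in B.
    assert (E := eq_trans (eq_sym A) B).
    assert (P := PI_RGT_0).
    apply Rmult_eq_reg_r with (/ (2 * PI)); [|apply Rinv_neq_0_compat; lra].
    rewrite Rmult_0_l; exact E.
  - intros l Hl; apply Ha0; lia.
  - intros t Ht; apply Ha; trivial; lia.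
Qed.

(** * Waves on the sphere *)

Definition cis (m : Z) (lam : R) : C := (cos (IZR m * lam), sin (IZR m * lam)).

(** A complex amplitude and a real profile make the class stable: [dlam] acts on z alone, [dmu] on h
    alone, and a bracket of two waves of amplitude 1 is again a wave. *)
Definition wave (z : C) (m : Z) (h : R -> R) : scalar :=
  fun lam mu => (z * RtoC (h mu) * cis m lam)%C.

Lemma cis_add m n lam : cis (m + n) lam = (cis m lam * cis n lam)%C.
Proof.
  unfold cis; rewrite plus_IZR, Rmult_plus_distr_r, cos_plus, sin_plus.
  apply injective_projections; simpl; ring.
Qed.

Lemma cis_opp m lam : cis (- m) lam = Cconj (cis m lam).
Proof.
  unfold cis; rewrite opp_IZR, Ropp_mult_distr_l_reverse, cos_neg, sin_neg; easy.
Qed.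

Lemma Y_wave l m lam mu : Y l m lam mu = wave (RtoC 1) m (radial l m) lam mu.
Proof.
  unfold Y, Ynonneg, wave, radial, norm_const, cis, assoc_legendre.
  fold (leg l (Z.to_nat m)) (leg l (Z.abs_nat m)).
  assert (F : INR (fact l) <> 0 /\ 2 ^ l <> 0).
  { split; [apply INR_fact_neq_0 | apply pow_nonzero; lra]. }
  destruct (Z.leb_spec 0 m) as [P|P].
  - replace (Z.to_nat m) with (Z.abs_nat m) by lia.
    rewrite (INR_IZR_INZ (Z.abs_nat m)), Zabs2Nat.id_abs, Z.abs_eq by lia.
    unfold leg; apply injective_projections; simpl; field; exact F.
  - rewrite (INR_IZR_INZ (Z.abs_nat m)), Zabs2Nat.id_abs, Z.abs_neq by lia.
    rewrite opp_IZR, Ropp_mult_distr_l_reverse, cos_neg, sin_neg.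
    assert (S : (-1) ^ Z.abs_nat m * (-1) ^ Z.abs_nat m = 1).
    { rewrite <- Rpow_mult_distr; replace (-1 * -1) with 1 by ring; apply pow1. }
    revert S; generalize ((-1) ^ Z.abs_nat m); intros s S.
    fold (leg l (Z.abs_nat m)).
    match goal with |- context [sqrt ?x] => generalize (sqrt x); intros r end.
    apply injective_projections; simpl.
    all: match goal with |- _ = ?B =>
      transitivity (s * s * B); [field; exact F | rewrite S; ring] end.
Qed.

Lemma dC_ext (f g : R -> C) t : (forall s, f s = g s) -> dC f t = dC g t.
Proof.
  intros H; unfold dC; f_equal; apply Derive_ext; intros s; now rewrite H.
Qed.

Lemma dC_ext_loc (f g : R -> C) t :
  locally t (fun s => f s = g s) -> dC f t = dC g t.
Proof.
  intros H; unfold dC; f_equal; apply Derive_ext_loc;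
    (eapply filter_imp; [|exact H]); intros s E; simpl; now rewrite E.
Qed.

Lemma dC_scal (z : C) (h : R -> R) t :
  dC (fun s => z * RtoC (h s))%C t = (z * RtoC (Derive h t))%C.
Proof.
  apply injective_projections; simpl.
  - rewrite (Derive_ext _ (fun s => fst z * h s)) by (intros s; ring).
    rewrite Derive_scal; change (fun s => h s) with h; ring.
  - rewrite (Derive_ext _ (fun s => snd z * h s)) by (intros s; ring).
    rewrite Derive_scal; change (fun s => h s) with h; ring.
Qed.

Lemma is_derive_cis (z : C) m t :
  is_derive (fun s => Re (z * cis m s)%C) t (Re (z * Ci * RtoC (IZR m) * cis m t)%C) /\
  is_derive (fun s => Im (z * cis m s)%C) t (Im (z * Ci * RtoC (IZR m) * cis m t)%C).
Proof.
  split; simpl; auto_derive; trivial; ring.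
Qed.

Lemma dC_cis (z : C) m t :
  dC (fun s => z * cis m s)%C t = (z * Ci * RtoC (IZR m) * cis m t)%C.
Proof.
  destruct (is_derive_cis z m t) as [H1 H2].
  apply injective_projections; now apply is_derive_unique.
Qed.

Lemma dlam_wave z m h lam mu :
  dlam (wave z m h) lam mu = wave (z * Ci * RtoC (IZR m))%C m h lam mu.
Proof.
  unfold dlam, wave; rewrite dC_cis; ring.
Qed.

Lemma dmu_wave z m h lam mu :
  dmu (wave z m h) lam mu = wave z m (Derive h) lam mu.
Proof.
  unfold dmu, wave.
  rewrite (dC_ext _ (fun s => (z * cis m lam) * RtoC (h s))%C) by (intros; ring).
  rewrite dC_scal; change (fun s => h s) with h; ring.
Qed.

Lemma bracket_wave m1 h1 m2 h2 lam mu :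
  bracket (wave (RtoC 1) m1 h1) (wave (RtoC 1) m2 h2) lam mu
  = wave Ci (m1 + m2) (radial_bracket m1 h1 m2 h2) lam mu.
Proof.
  unfold bracket; rewrite !dlam_wave, !dmu_wave.
  unfold wave, radial_bracket; rewrite cis_add.
  rewrite RtoC_minus, !RtoC_mult; ring.
Qed.

Definition eq_on_chart (f g : scalar) : Prop :=
  forall lam mu, chart lam mu -> f lam mu = g lam mu.

Lemma dlam_chart f g : eq_on_chart f g -> eq_on_chart (dlam f) (dlam g).
Proof.
  intros H lam mu [Hl Hm]; apply dC_ext_loc.
  apply (locally_interval _ lam 0 (2 * PI)); simpl; try tauto.
  intros s H1 H2; apply H; now split.
Qed.

Lemma dmu_chart f g : eq_on_chart f g -> eq_on_chart (dmu f) (dmu g).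
Proof.
  intros H lam mu [Hl Hm]; apply dC_ext_loc.
  apply (locally_interval _ mu (-1) 1); simpl; try tauto.
  intros s H1 H2; apply H; now split.
Qed.

(** The hypotheses concern gradients rather than functions because a vector field determines only
    the gradient of its stream function. *)
Lemma bracket_chart_gradient f f' g g' :
  eq_on_chart (dlam f) (dlam f') -> eq_on_chart (dmu f) (dmu f') ->
  eq_on_chart (dlam g) (dlam g') -> eq_on_chart (dmu g) (dmu g') ->
  eq_on_chart (bracket f g) (bracket f' g').
Proof.
  intros A B C D lam mu H; unfold bracket.
  now rewrite (A _ _ H), (B _ _ H), (C _ _ H), (D _ _ H).
Qed.

Lemma laplacian_chart_gradient f f' :
  eq_on_chart (dlam f) (dlam f') -> eq_on_chart (dmu f) (dmu f') ->
  eq_on_chart (laplacian f) (laplacian f').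
Proof.
  intros A B lam mu H; unfold laplacian.
  rewrite (dlam_chart _ _ A _ _ H); f_equal.
  apply dmu_chart; trivial.
  intros a b K; now rewrite (B _ _ K).
Qed.

Lemma laplacian_wave z m h g :
  legendre_op m h g -> eq_on_chart (laplacian (wave z m h)) (wave z m g).
Proof.
  intros H lam mu [Hl Hm]; unfold laplacian.
  assert (E1 : dmu (fun a b => RtoC (1 - b ^ 2) * dmu (wave z m h) a b)%C lam mu
          = wave z m (Derive (fun t => (1 - t ^ 2) * Derive h t)) lam mu).
  { rewrite <- dmu_wave; apply dC_ext; intros s.
    rewrite dmu_wave; unfold wave; rewrite RtoC_mult; ring. }
  assert (E2 : dlam (dlam (wave z m h)) lam mu = wave (- z * RtoC (IZR m ^ 2))%C m h lam mu).
  { unfold dlam at 1.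
    rewrite (dC_ext _ (fun t => wave (z * Ci * RtoC (IZR m))%C m h t mu))
      by (intros s; apply dlam_wave).
    change (dC (fun t => wave (z * Ci * RtoC (IZR m))%C m h t mu) lam)
      with (dlam (wave (z * Ci * RtoC (IZR m))%C m h) lam mu).
    rewrite dlam_wave; unfold wave; apply injective_projections; simpl; ring. }
  rewrite E1, E2; unfold wave.
  rewrite <- (legendre_op_Derive m h g mu H Hm).
  apply injective_projections; simpl; unfold Rdiv; ring.
Qed.

(** * Complex integrals over longitude *)

Lemma scal_C (r : R) (z : C) : scal (V := C_R_NormedModule) r z = (RtoC r * z)%C.
Proof.
  apply injective_projections; do 3 (unfold scal, mult; simpl); eq_in_R; ring.
Qed.

Lemma is_RInt_C (f : R -> C) a b (c : C) :
  is_RInt (fun t => Re (f t)) a b (Re c) -> is_RInt (fun t => Im (f t)) a b (Im c) ->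
  is_RInt (V := C_R_NormedModule) f a b c.
Proof.
  intros A B; rewrite (surjective_pairing c).
  now apply (is_RInt_fct_extend_pair (U := R_NormedModule) (V := R_NormedModule)).
Qed.

Lemma sin_Z_2PI n : sin (IZR n * (2 * PI)) = 0.
Proof.
  apply sin_eq_0_1; exists (2 * n)%Z; rewrite mult_IZR; ring.
Qed.

Lemma cos_Z_2PI n : cos (IZR n * (2 * PI)) = 1.
Proof.
  replace (IZR n * (2 * PI)) with (2 * (IZR n * PI)) by ring.
  rewrite cos_2a_sin, sin_eq_0_1; [ring | now exists n].
Qed.

Lemma is_RInt_cis z n :
  is_RInt (V := C_R_NormedModule) (fun t => z * cis n t)%C 0 (2 * PI)
    (if Z.eq_dec n 0 then z * RtoC (2 * PI) else RtoC 0)%C.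
Proof.
  destruct (Z.eq_dec n 0) as [->|ne].
  - apply is_RInt_ext with (fun _ => z).
    { intros t _; unfold cis; rewrite Rmult_0_l, cos_0, sin_0.
      apply injective_projections; simpl; ring. }
    evar_last; [apply is_RInt_const|].
    rewrite scal_C; apply injective_projections; simpl; ring.
  - apply not_0_IZR in ne.
    (* w = z / (i n), so that w times [cis n] is a 2 * PI periodic antiderivative of the
       integrand. *)
    set (w := (- z * Ci * RtoC (/ IZR n))%C).
    assert (E : forall t, (z * cis n t)%C = (w * Ci * RtoC (IZR n) * cis n t)%C).
    { intros t; apply injective_projections; simpl; field; trivial. }
    assert (D := is_derive_cis w n).
    assert (V : forall t, t = 0 \/ t = 2 * PI -> (w * cis n t)%C = w).
    { intros t [->| ->]; unfold cis.
      - rewrite Rmult_0_r, cos_0, sin_0; apply injective_projections; simpl; ring.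
      - rewrite cos_Z_2PI, sin_Z_2PI; apply injective_projections; simpl; ring. }
    apply is_RInt_ext with (fun t => (w * Ci * RtoC (IZR n) * cis n t)%C).
    { intros t _; now rewrite E. }
    apply is_RInt_C.
    + evar_last.
      * apply (is_RInt_derive (fun t => Re (w * cis n t)%C)).
        -- intros t _; apply D.
        -- intros t _; apply @ex_derive_continuous; simpl; auto_derive; trivial.
      * rewrite !V by tauto; unfold minus, plus, opp; simpl; eq_in_R; ring.
    + evar_last.
      * apply (is_RInt_derive (fun t => Im (w * cis n t)%C)).
        -- intros t _; apply D.
        -- intros t _; apply @ex_derive_continuous; simpl; auto_derive; trivial.
      * rewrite !V by tauto; unfold minus, plus, opp; simpl; eq_in_R; ring.
Qed.

(** * Inner products *)

(** Unlike [inner], whose [RInt] returns a value even for a non-integrable function, this relation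
    records that both iterated integrals exist, which is what additivity requires. *)
Definition is_inner (f g : scalar) (c : C) : Prop :=
  exists k : R -> C,
    (forall mu, -1 < mu < 1 ->
      is_RInt (V := C_R_NormedModule)
        (fun lam => (f lam mu * Cconj (g lam mu))%C) 0 (2 * PI) (k mu)) /\
    is_RInt (V := C_R_NormedModule) k (-1) 1 c.

Lemma is_inner_unique f g c : is_inner f g c -> inner f g = c.
Proof.
  intros [k [H1 H2]]; unfold inner; apply (is_RInt_unique (V := C_R_CompleteNormedModule)).
  apply is_RInt_ext with (2 := H2).
  rewrite Rmin_left, Rmax_right by lra; intros mu Hmu.
  symmetry; apply (is_RInt_unique (V := C_R_CompleteNormedModule)); now apply H1.
Qed.

Lemma is_inner_chart f f' g g' c :
  eq_on_chart f f' -> eq_on_chart g g' -> is_inner f g c -> is_inner f' g' c.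
Proof.
  intros Hf Hg [k [H1 H2]]; exists k; split; trivial.
  intros mu Hmu; apply is_RInt_ext with (2 := H1 mu Hmu).
  assert (P := PI_RGT_0).
  rewrite Rmin_left, Rmax_right by lra; intros lam Hl.
  now rewrite Hf, Hg by (now split).
Qed.

Lemma is_inner_sum (F : nat -> scalar) g (c : nat -> C) a b :
  (forall k, (a <= k <= b)%nat -> is_inner (F k) g (c k)) ->
  is_inner (fun lam mu => sum_n_m (fun k => F k lam mu) a b) g (sum_n_m c a b).
Proof.
  assert (Z0 : forall b, (b < a)%nat ->
    is_inner (fun lam mu => sum_n_m (fun k => F k lam mu) a b) g (sum_n_m c a b)).
  { intros b' L; exists (fun _ => RtoC 0).
    assert (Z : is_RInt (V := C_R_NormedModule) (fun _ => RtoC 0) 0 (2 * PI) (RtoC 0) /\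
                is_RInt (V := C_R_NormedModule) (fun _ => RtoC 0) (-1) 1 (RtoC 0)).
    { split; (evar_last; [apply is_RInt_const|]);
        rewrite scal_C; apply injective_projections; simpl; ring. }
    rewrite (sum_n_m_zero c) by trivial; split; [|apply Z].
    intros mu _; eapply is_RInt_ext; [|apply Z].
    intros lam _; simpl; rewrite sum_n_m_zero by trivial.
    apply injective_projections; simpl; ring. }
  assert (St : forall b, (a <= S b)%nat ->
    is_inner (fun lam mu => sum_n_m (fun k => F k lam mu) a b) g (sum_n_m c a b) ->
    is_inner (F (S b)) g (c (S b)) ->
    is_inner (fun lam mu => sum_n_m (fun k => F k lam mu) a (S b)) g (sum_n_m c a (S b))).
  { intros b' L [k [H1 H2]] [k' [H1' H2']].
    exists (fun mu => plus (k mu) (k' mu)); split.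
    - intros mu Hmu.
      eapply is_RInt_ext; [|exact (is_RInt_plus _ _ _ _ _ _ (H1 mu Hmu) (H1' mu Hmu))].
      intros lam _; simpl; rewrite sum_n_Sm by trivial.
      change plus with Cplus; ring.
    - rewrite sum_n_Sm by trivial.
      exact (is_RInt_plus _ _ _ _ _ _ H2 H2'). }
  induction b as [|b IH]; intros H.
  - destruct (Nat.eq_dec a 0) as [->|ne]; [|apply Z0; lia].
    rewrite sum_n_n; apply is_inner_chart with (F 0%nat) g; [| easy |apply H; lia].
    intros lam mu _; now rewrite sum_n_n.
  - destruct (Nat.le_gt_cases a (S b)) as [L|L]; [|now apply Z0].
    apply St; trivial; [apply IH; intros k Hk; apply H; lia | apply H; lia].
Qed.

Lemma is_RInt_wave z m h z' m' h' mu :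
  is_RInt (V := C_R_NormedModule)
    (fun lam => (wave z m h lam mu * Cconj (wave z' m' h' lam mu))%C) 0 (2 * PI)
    (if Z.eq_dec (m - m') 0
     then (z * Cconj z' * RtoC (h mu * h' mu)) * RtoC (2 * PI) else RtoC 0)%C.
Proof.
  eapply is_RInt_ext; [|apply is_RInt_cis].
  intros lam _; simpl; unfold Z.sub; rewrite cis_add, cis_opp; unfold wave.
  rewrite RtoC_mult; apply injective_projections; simpl; ring.
Qed.

Lemma is_inner_wave z m h z' h' c :
  is_RInt (fun t => h t * h' t) (-1) 1 c ->
  is_inner (wave z m h) (wave z' m h') (z * Cconj z' * RtoC (2 * PI * c))%C.
Proof.
  intros H; eexists; split; [intros mu _; apply is_RInt_wave|]; cbv beta.
  rewrite Z.sub_diag; destruct (Z.eq_dec 0 0) as [_|]; [|easy].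
  apply is_RInt_C.
  - apply is_RInt_ext with (fun t => scal (Re (z * Cconj z')%C * (2 * PI)) (h t * h' t)).
    { intros t _; unfold scal; simpl; unfold mult; simpl; eq_in_R; ring. }
    evar_last; [apply (is_RInt_scal (V := R_NormedModule)), H|].
    unfold scal; simpl; unfold mult; simpl; eq_in_R; ring.
  - apply is_RInt_ext with (fun t => scal (Im (z * Cconj z')%C * (2 * PI)) (h t * h' t)).
    { intros t _; unfold scal; simpl; unfold mult; simpl; eq_in_R; ring. }
    evar_last; [apply (is_RInt_scal (V := R_NormedModule)), H|].
    unfold scal; simpl; unfold mult; simpl; eq_in_R; ring.
Qed.

Lemma is_inner_wave_neq z m h z' m' h' :
  m <> m' -> is_inner (wave z m h) (wave z' m' h') (RtoC 0).
Proof.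
  intros ne; eexists; split; [intros mu _; apply is_RInt_wave|]; cbv beta.
  destruct (Z.eq_dec (m - m') 0); [lia|].
  evar_last; [apply is_RInt_const|].
  rewrite scal_C; apply injective_projections; simpl; ring.
Qed.

Lemma is_inner_Y z l m l0 m0 :
  (Z.abs m <= Z.of_nat l)%Z ->
  is_inner (fun lam mu => z * Y l m lam mu)%C (Y l0 m0)
    (if Nat.eq_dec l l0 then if Z.eq_dec m m0 then z else RtoC 0 else RtoC 0).
Proof.
  intros L.
  apply is_inner_chart with (wave z m (radial l m)) (wave (RtoC 1) m0 (radial l0 m0)).
  { intros lam mu _; rewrite Y_wave; unfold wave; ring. }
  { intros lam mu _; now rewrite Y_wave. }
  assert (P := PI_RGT_0).
  destruct (Z.eq_dec m m0) as [<-|ne].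
  - assert (H := is_inner_wave z m (radial l m) (RtoC 1) _ _ (is_RInt_radial l l0 m L)).
    destruct (Nat.eq_dec l l0).
    + replace (z * Cconj (RtoC 1) * RtoC (2 * PI * / (2 * PI)))%C with z in H; trivial.
      apply injective_projections; simpl; field; lra.
    + replace (z * Cconj (RtoC 1) * RtoC (2 * PI * 0))%C with (RtoC 0) in H; trivial.
      apply injective_projections; simpl; ring.
  - destruct (Nat.eq_dec l l0); now apply is_inner_wave_neq.
Qed.

(** * Expansions in spherical harmonics and uniqueness of their coefficients *)

Lemma sum_order_zero {A : AbelianMonoid} l (F : Z -> A) :
  (forall m, (Z.abs m <= Z.of_nat l)%Z -> F m = zero) -> sum_order l F = zero.
Proof.
  intros H; apply sum_n_m_zero_loc; intros k Hk; apply H; lia.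
Qed.

Lemma sum_order_single {A : AbelianMonoid} l (F : Z -> A) m0 :
  (Z.abs m0 <= Z.of_nat l)%Z ->
  (forall m, (Z.abs m <= Z.of_nat l)%Z -> m <> m0 -> F m = zero) ->
  sum_order l F = F m0.
Proof.
  intros L H; unfold sum_order.
  rewrite (sum_n_m_single _ 0 (2 * l) (Z.to_nat (m0 + Z.of_nat l))).
  - f_equal; lia.
  - lia.
  - intros k Hk ne; apply H; lia.
Qed.

(** Orthonormality leaves a single term of the double sum. If l0 exceeds the cutoff N, no term is
    left and [is_expansion] gives G l0 m0 = 0 as well. *)
Lemma is_inner_expansion h G l0 m0 :
  is_expansion h G -> (Z.abs m0 <= Z.of_nat l0)%Z -> is_inner h (Y l0 m0) (G l0 m0).
Proof.
  intros [N [HN Hh]] L0.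
  set (c := fun l m => if Nat.eq_dec l l0 then
              if Z.eq_dec m m0 then G l m else RtoC 0 else RtoC 0).
  assert (H : is_inner h (Y l0 m0) (sum_n_m (fun l => sum_order l (c l)) 0 N)).
  { apply is_inner_chart with (g := Y l0 m0) (f := fun lam mu =>
      sum_n_m (fun l => sum_order l (fun m => (G l m * Y l m lam mu)%C)) 0 N).
    - intros lam mu K; symmetry; now apply Hh.
    - easy.
    - apply (is_inner_sum (fun l lam mu => sum_order l (fun m => (G l m * Y l m lam mu)%C))).
      intros l _.
      apply (is_inner_sum (fun k lam mu =>
        (G l (Z.of_nat k - Z.of_nat l)%Z * Y l (Z.of_nat k - Z.of_nat l) lam mu)%C)
        _ (fun k => c l (Z.of_nat k - Z.of_nat l)%Z)).
      intros k Hk; apply is_inner_Y; lia. }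
  assert (S0 : forall l, l <> l0 -> sum_order l (c l) = zero).
  { intros l ne; apply sum_order_zero; intros m _; unfold c.
    now destruct (Nat.eq_dec l l0). }
  destruct (Nat.le_gt_cases l0 N) as [L|L].
  - rewrite (sum_n_m_single _ 0 N l0), (sum_order_single l0 _ m0) in H; trivial; try lia.
    + unfold c in H; destruct (Nat.eq_dec l0 l0); [|easy].
      now destruct (Z.eq_dec m0 m0).
    + intros m _ ne; unfold c; destruct (Nat.eq_dec l0 l0); [|easy].
      now destruct (Z.eq_dec m m0).
    + intros k _ ne; now apply S0.
  - rewrite HN by trivial.
    rewrite sum_n_m_zero_loc in H; [exact H|].
    intros k Hk; apply S0; lia.
Qed.

Lemma is_expansion_unique h G G' l m :
  is_expansion h G -> is_expansion h G' -> (Z.abs m <= Z.of_nat l)%Z -> G l m = G' l m.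
Proof.
  intros H H' L.
  rewrite <- (is_inner_unique _ _ _ (is_inner_expansion h G l m H L)).
  now apply is_inner_unique, is_inner_expansion.
Qed.

Lemma mult_RtoC_sum_n (z w : C) (f : nat -> R) N :
  (z * RtoC (sum_n f N) * w)%C = sum_n (fun l => z * RtoC (f l) * w)%C N.
Proof.
  induction N as [|N IH]; [now rewrite !sum_O|].
  rewrite !sum_Sn, <- IH.
  change plus with Cplus at 2; change plus with Rplus; rewrite RtoC_plus; ring.
Qed.

Lemma bracket_Y_wave l1 m1 l2 m2 :
  eq_on_chart (wave Ci (m1 + m2) (radial_bracket m1 (radial l1 m1) m2 (radial l2 m2)))
    (bracket (Y l1 m1) (Y l2 m2)).
Proof.
  intros lam mu H; rewrite <- bracket_wave.
  assert (E : forall l m, eq_on_chart (wave (RtoC 1) m (radial l m)) (Y l m)).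
  { intros l m a b _; now rewrite Y_wave. }
  apply bracket_chart_gradient; trivial;
    (apply dlam_chart || apply dmu_chart); apply E.
Qed.

Lemma is_expansion_bracket_Y l1 m1 l2 m2 a :
  (forall l, (l < Z.abs_nat (m1 + m2))%nat -> a l = 0) ->
  (forall l, (l1 + l2 - 1 < l)%nat -> a l = 0) ->
  (forall t, -1 < t < 1 ->
      radial_bracket m1 (radial l1 m1) m2 (radial l2 m2) t
      = sum_n (fun l => a l * radial l (m1 + m2) t) (l1 + l2 - 1)) ->
  is_expansion (bracket (Y l1 m1) (Y l2 m2))
    (fun l m => if Z.eq_dec m (m1 + m2) then Ci * RtoC (a l) else RtoC 0)%C.
Proof.
  intros Hlow Hhigh Ha; exists (l1 + l2 - 1)%nat; split.
  - intros l m L _; destruct (Z.eq_dec m (m1 + m2)); [|easy].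
    rewrite Hhigh by trivial; apply Cmult_0_r.
  - intros lam mu K; rewrite <- bracket_Y_wave by trivial.
    unfold wave; rewrite Ha by apply K; rewrite mult_RtoC_sum_n.
    apply sum_n_m_ext; intros l.
    (* When l < |m1 + m2| the order m1 + m2 does not occur in the inner sum, in agreement with
       [a l = 0]. *)
    destruct (Nat.lt_ge_cases l (Z.abs_nat (m1 + m2))) as [L|L].
    + rewrite Hlow by trivial; rewrite sum_order_zero.
      * apply injective_projections; simpl; eq_in_R; ring.
      * intros m _; destruct (Z.eq_dec m (m1 + m2)); unfold zero; simpl;
          apply injective_projections; simpl; eq_in_R; ring.
    + rewrite (sum_order_single l _ (m1 + m2)).
      * destruct (Z.eq_dec (m1 + m2) (m1 + m2)) as [_|]; [|easy].
        rewrite Y_wave; unfold wave; rewrite RtoC_mult.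
        lazymatch goal with |- ?a = ?b => change (@eq C a b) end; ring.
      * lia.
      * intros m _ ne; destruct (Z.eq_dec m (m1 + m2)); [easy|].
        apply Cmult_0_l.
Qed.

(** * The Misiolek criterion *)

Lemma inner_chart f f' g g' :
  eq_on_chart f f' -> eq_on_chart g g' -> inner f g = inner f' g'.
Proof.
  intros Hf Hg; assert (P := PI_RGT_0).
  unfold inner; apply (RInt_ext (V := C_R_CompleteNormedModule)).
  rewrite Rmin_left, Rmax_right by lra; intros mu Hmu.
  apply (RInt_ext (V := C_R_CompleteNormedModule)).
  rewrite Rmin_left, Rmax_right by lra; intros lam Hlam.
  now rewrite Hf, Hg by (now split).
Qed.

(** The harmonics are themselves stream functions, so the choice in [MC] has a witness. Any other
    pair of stream functions has the same gradients on the chart, and these propagate through the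
    bracket and the Laplacian to both inner products. *)
Lemma MC_e_field l1 m1 l2 m2 :
  MC (e_field l1 m1) (e_field l2 m2) = MC_stream (Y l1 m1) (Y l2 m2).
Proof.
  assert (S : forall l m, stream (Y l m) (e_field l m)).
  { intros l m lam mu [_ Hm]; split; [|split; trivial].
    - apply ex_derive_ext with (fun t => plus
        (scal (V := C_R_NormedModule) (cos (IZR m * t)) (RtoC (radial l m mu)))
        (scal (V := C_R_NormedModule) (sin (IZR m * t)) (Ci * RtoC (radial l m mu))%C)).
      { intros t; rewrite Y_wave, !scal_C; apply injective_projections;
          unfold plus; simpl; unfold plus; simpl; eq_in_R; ring. }
      apply @ex_derive_plus; eexists; apply @is_derive_scal_l; auto_derive; trivial.
    - apply ex_derive_ext with (fun t =>
        scal (V := C_R_NormedModule) (radial l m t) (cis m lam)).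
      { intros t; rewrite Y_wave, scal_C; apply injective_projections;
          simpl; eq_in_R; ring. }
      eexists; apply @is_derive_scal_l; now apply is_derive_radial. }
  assert (P := epsilon_spec (inhabits (RtoC 0)) (fun c =>
    exists f g, stream f (e_field l1 m1) /\ stream g (e_field l2 m2) /\ c = MC_stream f g)
    ltac:(exists (MC_stream (Y l1 m1) (Y l2 m2)), (Y l1 m1), (Y l2 m2); auto)).
  fold (MC (e_field l1 m1) (e_field l2 m2)) in P.
  destruct P as [f [g [Hf [Hg ->]]]].
  assert (G : forall f l m, stream f (e_field l m) ->
    eq_on_chart (dlam f) (dlam (Y l m)) /\ eq_on_chart (dmu f) (dmu (Y l m))).
  { clear; intros f l m H; split; intros lam mu K;
      destruct (H lam mu K) as [_ [_ E]]; unfold e_field, gradperp in E.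
    - exact (eq_sym (f_equal snd E)).
    - assert (E1 := f_equal fst E); simpl in E1.
      transitivity (- - dmu f lam mu)%C; [ring|]; rewrite <- E1; ring. }
  apply G in Hf as [Fl Fm]; apply G in Hg as [Gl Gm].
  assert (B := bracket_chart_gradient _ _ _ _ Fl Fm Gl Gm).
  assert (D := laplacian_chart_gradient _ _ Fl Fm).
  assert (BD := bracket_chart_gradient _ _ _ _ (dlam_chart _ _ D) (dmu_chart _ _ D) Gl Gm).
  assert (DB := laplacian_chart_gradient _ _ (dlam_chart _ _ B) (dmu_chart _ _ B)).
  unfold MC_stream; now rewrite (inner_chart _ _ _ _ DB B), (inner_chart _ _ _ _ BD B).
Qed.

Lemma MC_stream_Y l1 m1 l2 m2 a :
  (forall l, (l < Z.abs_nat (m1 + m2))%nat -> a l = 0) ->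
  (forall t, -1 < t < 1 ->
      radial_bracket m1 (radial l1 m1) m2 (radial l2 m2) t
      = sum_n (fun l => a l * radial l (m1 + m2) t) (l1 + l2 - 1)) ->
  MC_stream (Y l1 m1) (Y l2 m2) = RtoC (sum_n (fun l =>
    a l ^ 2 * (INR l1 * (INR l1 + 1) - INR l * (INR l + 1))) (l1 + l2 - 1)).
Proof.
  intros Hlow Ha; set (N := (l1 + l2 - 1)%nat) in *; set (m := (m1 + m2)%Z) in *.
  assert (P := PI_RGT_0).
  set (ev := fun l : nat => - (INR l * (INR l + 1))).
  set (ser := fun (c : nat -> R) t => sum_n (fun l => c l * radial l m t) N).
  assert (W : forall z c c', (forall t, -1 < t < 1 -> c t = c' t) ->
              eq_on_chart (wave z m c) (wave z m c')).
  { intros z c c' H lam mu K; unfold wave; now rewrite H by apply K. }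
  assert (B : eq_on_chart (wave Ci m (ser a)) (bracket (Y l1 m1) (Y l2 m2))).
  { intros lam mu K; rewrite <- bracket_Y_wave by trivial.
    apply W; trivial; intros t Ht; symmetry; now apply Ha. }
  (* Both terms of the criterion are pairings of this form: the amplitudes give i times its
     conjugate, that is 1, and the longitude integral cancels / (2 * PI). *)
  assert (I : forall f c, eq_on_chart (wave Ci m (ser c)) f ->
    inner f (bracket (Y l1 m1) (Y l2 m2)) = RtoC (sum_n (fun l => c l * a l) N)).
  { intros f c Hf; apply is_inner_unique.
    apply is_inner_chart with (1 := Hf) (2 := B).
    assert (H := is_inner_wave Ci m _ Ci _ _ (is_RInt_radial_expansion m c a N Hlow)).
    assert (E : forall s : R, (Ci * Cconj Ci * RtoC (2 * PI * (s / (2 * PI))))%C = RtoC s).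
    { intros s; apply injective_projections; simpl; field; lra. }
    rewrite E in H; exact H. }
  unfold MC_stream.
  (* In the first term the Laplacian acts on each degree l of the bracket; in the second it acts on
     the first harmonic, giving the constant eigenvalue of l1. *)
  rewrite (I _ (fun l => a l * ev l)), (I _ (fun l => ev l1 * a l)).
  - rewrite <- RtoC_minus; f_equal.
    transitivity (sum_n (fun l => a l * ev l * a l) N
                  + sum_n (fun l => (-1) * (ev l1 * a l * a l)) N).
    { assert (E := sum_n_mult_l (K := R_Ring) (-1) (fun l => ev l1 * a l * a l) N).
      unfold Rminus; f_equal; symmetry; etransitivity; [exact E|].
      assert (M : forall x, (-1) * x = - x) by (intros; ring); apply M. }
    rewrite <- (sum_n_plus (G := R_AbelianGroup)).
    apply sum_n_ext; intros l; unfold plus; simpl; unfold ev; ring.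
  - intros lam mu K.
    transitivity (bracket (wave (RtoC 1) m1 (fun t => ev l1 * radial l1 m1 t))
                    (wave (RtoC 1) m2 (radial l2 m2)) lam mu).
    + rewrite bracket_wave; apply W; trivial; intros t Ht.
      unfold radial_bracket; rewrite Derive_scal.
      change (fun x => radial l1 m1 x) with (radial l1 m1).
      transitivity (ev l1 * ser a t).
      * unfold ser; rewrite <- (sum_n_mult_l (K := R_Ring)).
        apply sum_n_ext; intros l; unfold mult; simpl; ring.
      * unfold ser; rewrite <- Ha by trivial; unfold radial_bracket; ring.
    + assert (E : eq_on_chart (wave (RtoC 1) m1 (fun t => ev l1 * radial l1 m1 t))
                    (laplacian (Y l1 m1))).
      { intros x y K'; rewrite <- (laplacian_wave _ _ _ _ (legendre_op_radial l1 m1)) by trivial.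
        apply laplacian_chart_gradient; trivial;
          (apply dlam_chart || apply dmu_chart); intros x' y' _; now rewrite Y_wave. }
      apply bracket_chart_gradient; trivial;
        (apply dlam_chart || apply dmu_chart); trivial; intros x' y' _; now rewrite Y_wave.
  - intros lam mu K.
    transitivity (laplacian (wave Ci m (ser a)) lam mu).
    + symmetry; apply laplacian_wave; trivial.
      assert (H := legendre_op_sum m _ _ a N (fun l => legendre_op_radial l m)).
      destruct H as [h' H]; exists h'; intros t Ht; destruct (H t Ht) as [H1 H2].
      split; trivial; evar_last; [exact H2|].
      unfold ser; f_equal; apply sum_n_ext; intros l; unfold ev; eq_in_R; ring.
    + apply laplacian_chart_gradient; trivial;
        (apply dlam_chart || apply dmu_chart); exact B.
Qed.

Theorem proposition3p1 (l1 l2 : nat) (m1 m2 : Z)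
    (hl1 : (1 <= l1)%nat) (hl2 : (1 <= l2)%nat)
    (hm1 : (Z.abs m1 <= Z.of_nat l1)%Z) (hm2 : (Z.abs m2 <= Z.of_nat l2)%Z) :
  let g := real_structure_constant l1 m1 l2 m2 in
  let lo := (Z.abs_nat (Z.of_nat l1 - Z.of_nat l2) + 1)%nat in
  let hi := (l1 + l2 - 1)%nat in
  let total := sum_n_m (fun l3 : nat => sum_order l3 (fun m3 : Z =>
             (g l3 (- m3)%Z) ^ 2
             * (INR l1 * (INR l1 + 1) - INR l3 * (INR l3 + 1)))) lo hi in
  MC (e_field l1 m1) (e_field l2 m2) = RtoC total /\
  total = sum_n_m (fun l3 : nat =>
             (g l3 (- (m1 + m2))%Z) ^ 2
             * (INR l1 * (INR l1 + 1) - INR l3 * (INR l3 + 1))) lo hi.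
Proof.
  intros g lo hi total.
  destruct (radial_bracket_coefficients l1 m1 l2 m2 hl1 hl2 hm1 hm2)
    as [a [Hm [Hlo [Hhi Ha]]]]; fold lo in Hlo; fold hi in Hhi, Ha.
  assert (X := is_expansion_bracket_Y l1 m1 l2 m2 a Hm Hhi Ha).
  assert (GX := epsilon_spec (inhabits (fun _ _ => RtoC 0))
    (is_expansion (bracket (Y l1 m1) (Y l2 m2))) (ex_intro _ _ X)).
  fold (structure_constant l1 m1 l2 m2) in GX.
  assert (G : forall l m, (Z.abs m <= Z.of_nat l)%Z -> structure_constant l1 m1 l2 m2 l m
     = if Z.eq_dec m (m1 + m2) then (Ci * RtoC (a l))%C else RtoC 0).
  { intros l m L; exact (is_expansion_unique _ _ _ l m GX X L). }
  assert (Hsign : forall m, powerRZ (-1) m * powerRZ (-1) m = 1).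
  { intros m; destruct m as [|p|p]; simpl; [ring| |].
    - rewrite <- Rpow_mult_distr; replace (-1 * -1) with 1 by ring; apply pow1.
    - rewrite <- Rinv_mult, <- Rpow_mult_distr.
      replace (-1 * -1) with 1 by ring; rewrite pow1; apply Rinv_1. }
  assert (gX : exists g : nat -> Z -> R,
    (forall l3 m3, (Z.abs m3 <= Z.of_nat l3)%Z ->
       structure_constant l1 m1 l2 m2 l3 m3 =
       (- Ci * RtoC (powerRZ (-1) m3) * RtoC (g l3 (- m3)%Z))%C) /\
    (forall l3 m3, (Z.of_nat l3 < Z.abs m3)%Z -> g l3 m3 = 0)).
  (* Solving i a_l = -i (-1)^m g(l, -m) at m = m1 + m2 gives g(l, -m) = -(-1)^m a_l. The outer test
     enforces the convention that g is 0 for |m| > l. *)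
  { exists (fun l m => if Z_lt_dec (Z.of_nat l) (Z.abs m) then 0 else
      if Z.eq_dec (- m) (m1 + m2) then - powerRZ (-1) (- m) * a l else 0); split.
    - intros l m L; rewrite G by trivial.
      destruct (Z_lt_dec (Z.of_nat l) (Z.abs (- m))); [lia|].
      rewrite Z.opp_involutive; destruct (Z.eq_dec m (m1 + m2)).
      + transitivity (Ci * RtoC (powerRZ (-1) m * powerRZ (-1) m * a l))%C.
        * rewrite Hsign; apply injective_projections; simpl; ring.
        * apply injective_projections; simpl; ring.
      + apply injective_projections; simpl; ring.
    - intros l m L; now destruct (Z_lt_dec (Z.of_nat l) (Z.abs m)). }
  assert (Hg := epsilon_spec (inhabits (fun _ _ => 0)) _ gX).
  fold (real_structure_constant l1 m1 l2 m2) in Hg; fold g in Hg.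
  destruct Hg as [Hg Hg0].
  assert (Hsq : forall l m, (Z.abs m <= Z.of_nat l)%Z ->
     g l (- m)%Z ^ 2 = if Z.eq_dec m (m1 + m2) then a l ^ 2 else 0).
  { intros l m L; assert (E := Hg l m L); rewrite G in E by trivial.
    apply (f_equal snd) in E; simpl in E.
    transitivity ((powerRZ (-1) m * g l (- m)%Z) ^ 2).
    - transitivity (powerRZ (-1) m * powerRZ (-1) m * g l (- m)%Z ^ 2);
        [rewrite Hsign|]; ring.
    - destruct (Z.eq_dec m (m1 + m2)); simpl in E.
      + replace (powerRZ (-1) m * g l (- m)%Z) with (- a l) by lra; ring.
      + replace (powerRZ (-1) m * g l (- m)%Z) with 0 by lra; ring. }
  (* The range of l3 may start below |m1 + m2|, where the defining equation of g says nothing at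
     this order; there both sides are 0, by the convention on g and by [Hm]. *)
  assert (Hsq' : forall l, g l (- (m1 + m2))%Z ^ 2 = a l ^ 2).
  { intros l; destruct (Z_lt_ge_dec (Z.of_nat l) (Z.abs (m1 + m2))).
    - rewrite Hg0, Hm by lia; ring.
    - rewrite Hsq by lia; now destruct (Z.eq_dec (m1 + m2) (m1 + m2)). }
  assert (T : total = sum_n_m (fun l3 : nat => (g l3 (- (m1 + m2))%Z) ^ 2
             * (INR l1 * (INR l1 + 1) - INR l3 * (INR l3 + 1))) lo hi).
  { apply sum_n_m_ext; intros l.
    destruct (Z_lt_ge_dec (Z.of_nat l) (Z.abs (m1 + m2))).
    - rewrite sum_order_zero; [rewrite Hg0 by lia; unfold zero; simpl; eq_in_R; ring|].
      intros m L; rewrite Hsq by trivial; destruct (Z.eq_dec m (m1 + m2)); [lia|].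
      apply Rmult_0_l.
    - rewrite (sum_order_single l _ (m1 + m2)); trivial; [lia|].
      intros m L ne; rewrite Hsq by trivial; destruct (Z.eq_dec m (m1 + m2)); [easy|].
      apply Rmult_0_l. }
  split; trivial.
  rewrite MC_e_field, (MC_stream_Y l1 m1 l2 m2 a Hm Ha), T; f_equal.
  fold hi; unfold sum_n.
  assert (E : forall l, a l ^ 2 * (INR l1 * (INR l1 + 1) - INR l * (INR l + 1)) =
    g l (- (m1 + m2))%Z ^ 2 * (INR l1 * (INR l1 + 1) - INR l * (INR l + 1))).
  { intros l; now rewrite Hsq'. }
  rewrite (sum_n_m_ext _ _ 0 hi E).
  (* [MC_stream_Y] sums from degree 0; the degrees up to |l1 - l2| are split off and vanish by
     [Hlo]. *)
  assert (L : (lo = S (pred lo))%nat) by lia.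
  rewrite (sum_n_m_Chasles _ 0 (pred lo) hi) by lia.
  rewrite <- L, sum_n_m_zero_loc; [apply plus_zero_l|].
  intros l Hl; rewrite Hsq', Hlo by lia; unfold zero; simpl; ring.
Qed.
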